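(* Let $n\geq 2$ be an integer, let $1/3<d<1$, and for each $k\ge 3$ let $\Gamma_{k}\sim \Gamma (n,k,d)$ be a random group in the strict $(n,k,d)$ model. Then $$\lim_{k\rightarrow\infty }\mathbb{P}(\Gamma_{k}\text{ has Property }(T))=1.$$
   Context: Strict $(n,k,d)$ model: for $n\ge 2$, $k\ge 3$, $0<d<1$, let $A_n=\{a_1,\dots,a_n\}$ and let $F_n$ be the free group on $A_n$. Let $\mathcal{C}(n,k)$ be the set of cyclically reduced words of length $k$ in $F_n$. Choose uniformly at random a subset $R\subseteq\mathcal{C}(n,k)$ of size $|R|=(2n-1)^{kd}$ (quantities that must be integers are implicitly replaced by their integer part), and let $\Gamma=\langle A_n\mid R\rangle$. One writes $\Gamma\sim\Gamma(n,k,d)$. Property (T): a finitely generated group $\Gamma$ with finite generating set $S$ has Property (T) if every unitary representation $\pi$ of $\Gamma$ on a Hilbert space $\mathcal{H}$ with almost-invariant vectors (for every $\epsilon>0$ there is a non-zero $u\in\mathcal{H}$ with $\|\pi(s)u-u\|<\epsilon\|u\|$ for all $s\in S$) has a non-zero invariant vector. *)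

(* Defs.v *)
From HB Require Import structures.
From mathcomp Require Import all_boot all_order all_algebra.
From mathcomp Require Import complex.
From mathcomp Require Import all_classical all_reals all_analysis.

Set Implicit Arguments.
Unset Strict Implicit.
Unset Printing Implicit Defensive.

Import Order.TTheory GRing.Theory Num.Theory.
Import numFieldNormedType.Exports.

Local Open Scope quotient_scope.
Local Open Scope classical_set_scope.
Local Open Scope ring_scope.

Section Presentation.
Variable A : choiceType.

(* The letter (a, false) stands for a and (a, true) for a^-1. *)
Definition letter : Type := A * bool.
HB.instance Definition _ := Choice.on letter.
Definition letter_inv (x : letter) : letter := (x.1, ~~ x.2).

Definition word : Type := seq letter.
HB.instance Definition _ := Choice.on word.
Definition word_inv (w : word) : word := rev (map letter_inv w).

Lemma letter_invK : involutive letter_inv.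
Proof. by case=> a b; rewrite /letter_inv /= negbK. Qed.

Lemma word_invK : involutive word_inv.
Proof.
by move=> w; rewrite /word_inv map_rev revK -map_comp map_id_in // => x _;
  exact: letter_invK.
Qed.

Lemma word_inv_cat (u v : word) : word_inv (u ++ v) = word_inv v ++ word_inv u.
Proof. by rewrite /word_inv map_cat rev_cat. Qed.

Variable rels : set word.

Inductive pres_eq : word -> word -> Prop :=
| pres_refl u : pres_eq u u
| pres_sym u v : pres_eq u v -> pres_eq v u
| pres_trans u v w : pres_eq u v -> pres_eq v w -> pres_eq u w
| pres_cat u u' v v' :
    pres_eq u u' -> pres_eq v v' -> pres_eq (u ++ v) (u' ++ v')
| pres_cancel x : pres_eq [:: x; letter_inv x] [::]
| pres_rel r : rels r -> pres_eq r [::].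

Definition pres_eqb (u v : word) : bool := `[< pres_eq u v >].

Lemma pres_eqb_refl : reflexive pres_eqb.
Proof. by move=> u; apply/asboolP; exact: pres_refl. Qed.

Lemma pres_eqb_sym : symmetric pres_eqb.
Proof. by move=> u v; apply/asboolP/asboolP; exact: pres_sym. Qed.

Lemma pres_eqb_trans : transitive pres_eqb.
Proof.
move=> v u w /asboolP uv /asboolP vw; apply/asboolP; exact: pres_trans uv vw.
Qed.

Canonical pres_equiv :=
  EquivRel pres_eqb pres_eqb_refl pres_eqb_sym pres_eqb_trans.

(* The group < A | rels >. *)
Definition presented := {eq_quot pres_equiv}.
HB.instance Definition _ := Choice.on presented.
HB.instance Definition _ := Quotient.on presented.

Definition word_class (w : word) : presented := \pi_presented w.

Lemma word_class_eq (u v : word) : word_class u = word_class v <-> pres_eq u v.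
Proof. by split=> [/eqmodP/asboolP //|h]; apply/eqmodP/asboolP. Qed.

Lemma pres_repr (w : word) : pres_eq (repr (word_class w)) w.
Proof. by apply/word_class_eq; exact: reprK. Qed.

Lemma pres_invr (w : word) : pres_eq (w ++ word_inv w) [::].
Proof.
elim: w => [|x w IHw]; first exact: pres_refl.
rewrite -cat1s word_inv_cat -catA (catA w).
have h : pres_eq ((w ++ word_inv w) ++ word_inv [:: x]) (word_inv [:: x]).
  rewrite -[X in pres_eq _ X]cat0s; apply: pres_cat => //; exact: pres_refl.
apply: pres_trans (pres_cat (pres_refl [:: x]) h) _; exact: pres_cancel.
Qed.

Lemma pres_inv (u v : word) :
  pres_eq u v -> pres_eq (word_inv u) (word_inv v).
Proof.
move=> uv; apply: (@pres_trans _ (word_inv u ++ (v ++ word_inv v))).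
  rewrite -[X in pres_eq X _]cats0; apply: pres_cat; first exact: pres_refl.
  exact/pres_sym/pres_invr.
apply: (@pres_trans _ (word_inv u ++ (u ++ word_inv v))).
  apply: pres_cat (pres_refl _) (pres_cat (pres_sym uv) (pres_refl _)).
rewrite catA -[X in pres_eq _ X]cat0s; apply: pres_cat; last exact: pres_refl.
by rewrite -[X in _ ++ X]word_invK; exact: pres_invr.
Qed.

Definition pres_one : presented := word_class [::].
Definition pres_mul (x y : presented) : presented :=
  word_class (repr x ++ repr y).
Definition pres_invg (x : presented) : presented :=
  word_class (word_inv (repr x)).

Lemma word_class_repr (x : presented) : word_class (repr x) = x.
Proof. exact: reprK. Qed.

Lemma word_class_mul (u v : word) :
  pres_mul (word_class u) (word_class v) = word_class (u ++ v).
Proof. by apply/word_class_eq/pres_cat; exact: pres_repr. Qed.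

Lemma word_class_inv (u : word) : pres_invg (word_class u) = word_class (word_inv u).
Proof. by apply/word_class_eq/pres_inv; exact: pres_repr. Qed.

Lemma pres_mulA : associative pres_mul.
Proof.
move=> x y z; rewrite -(word_class_repr x) -(word_class_repr y) -(word_class_repr z).
by rewrite !word_class_mul catA.
Qed.

Lemma pres_mul1 : left_id pres_one pres_mul.
Proof. by move=> x; rewrite -(word_class_repr x) word_class_mul. Qed.

Lemma pres_mulr1 : right_id pres_one pres_mul.
Proof. by move=> x; rewrite -(word_class_repr x) word_class_mul cats0. Qed.

Lemma pres_mulV : left_inverse pres_one pres_invg pres_mul.
Proof.
move=> x; rewrite -(word_class_repr x) word_class_inv word_class_mul.
apply/word_class_eq; rewrite -[X in _ ++ X]word_invK; exact: pres_invr.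
Qed.

Lemma pres_mulrV : right_inverse pres_one pres_invg pres_mul.
Proof.
move=> x; rewrite -(word_class_repr x) word_class_inv word_class_mul.
by apply/word_class_eq; exact: pres_invr.
Qed.

HB.instance Definition _ := isGroup.Build presented
  pres_mulA pres_mul1 pres_mulr1 pres_mulV pres_mulrV.

End Presentation.

Section PropertyT.
Local Open Scope complex_scope.

Definition generates (G : groupType) (S : seq G) : Prop :=
  forall K : set G,
    K 1%g ->
    (forall x y, K x -> K y -> K (x * y)%g) ->
    (forall x, K x -> K x^-1%g) ->
    (forall s, s \in S -> K s) ->
  forall g, K g.

(* A complex Hilbert space is a complete normed space H over R[i] together with
   an inner product (linear in its first variable) inducing its norm. *)
Definition inner_product (R : realType) (H : completeNormedModType R[i])
    (ip : {dot H for @Num.conj R[i]}) : Prop :=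
  forall u : H, `|u| ^+ 2 = ip u u.

Definition unitary_rep (R : realType) (G : groupType)
    (H : completeNormedModType R[i]) (ip : {dot H for @Num.conj R[i]})
    (pi : G -> {linear H -> H}) : Prop :=
  [/\ forall u, pi 1%g u = u,
      forall g h u, pi (g * h)%g u = pi g (pi h u)
    & forall g u v, ip (pi g u) (pi g v) = ip u v].

Definition almost_invariant (R : realType) (G : groupType) (S : seq G)
    (H : completeNormedModType R[i]) (pi : G -> {linear H -> H}) : Prop :=
  forall eps : R, 0 < eps ->
    exists2 u : H, u != 0 &
      forall s, s \in S -> `|pi s u - u| < eps%:C * `|u|.

(* Property (T) makes sense for finitely generated groups and does not depend on
   the finite generating set S, listed here as a sequence. *)
Definition propertyT (R : realType) (G : groupType) : Prop :=
  exists2 S : seq G, generates S &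
    forall (H : completeNormedModType R[i]) (ip : {dot H for @Num.conj R[i]})
           (pi : G -> {linear H -> H}),
      inner_product ip -> unitary_rep ip pi -> almost_invariant S pi ->
    exists2 u : H, u != 0 & forall g, pi g u = u.

End PropertyT.

(* The probability of the event E under the uniform law on Omega. *)
Definition uniform_on_prob (R : realType) (T : finType) (Omega : {set T})
    (E : T -> Prop) : R :=
  #|[set x in Omega | `[< E x >]]%SET|%:R / #|Omega|%:R.

Section StrictModel.
Variables n k : nat.

Definition relator : finType := k.-tuple ('I_n * bool).

(* Elements of the free group on 'I_n are represented by their reduced words.
   The adjacency condition is cyclic: it also compares the last letter with the
   first one. *)
Definition cyclically_reduced (w : word 'I_n) : bool :=
  cycle (fun x y => y != letter_inv x) w.

Definition cyc_red_words : {set relator} :=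
  [set w : relator | cyclically_reduced (tval w)]%SET.

Definition random_group (rs : {set relator}) : groupType :=
  presented [set w : word 'I_n | exists2 r : relator, r \in rs & w = tval r].

Variables (R : realType) (d : R).

(* The integer part of (2n - 1)^(kd). *)
Definition num_relators : nat := Num.truncn ((2 * n - 1)%N%:R `^ (k%:R * d)).

Definition relator_sets : {set {set relator}} :=
  [set rs : {set relator} |
    (rs \subset cyc_red_words) && (#|rs| == num_relators)]%SET.

Definition prob_propertyT : R :=
  uniform_on_prob R relator_sets (fun rs => propertyT R (random_group rs)).

End StrictModel.

(* Main.v *)
Require Import Defs.
From HB Require Import structures.
From mathcomp Require Import all_boot all_order all_algebra.
From mathcomp Require Import complex.
From mathcomp Require Import all_classical all_reals all_analysis.
From mathcomp Require Import zify ring lra.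

(** Write b = 2n - 1 and split a relator of length k into three pieces of
    length about k / 3.  Restrict to relators x y z whose pieces come from a
    set X of about b ^ (k / 3) words starting with a fixed letter a and not
    ending with its inverse, the last piece being padded by a few letters a:
    then every concatenation is cyclically reduced, and the relators of this
    shape form a positive proportion of all.  In the presented group each
    such relator is a triangle with sides x, y, z, and since d > 1/3 a given
    x lies on about b ^ (k (d - 1/3)) of them.  This number D tends to
    infinity, so the random triangles are spread almost uniformly over X^3.

    Spread of the triangles implies property (T).  For a triple of vectors
    (v0, v1, v2) of a unitary representation, consider the energy, the sum
    of the means over X of |v0 - x v1|^2, |v1 - y v2|^2 and |v2 - z v0|^2.
    On a triangle the distance of y v2 to v1 is that of the other two
    endpoints x v1 and z^-1 v2, so the expansion of the links bounds the
    energy by the squared length of its gradient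
    ([link_inequality], [energy_le_slope]).  Gradient descent then divides the
    energy by a definite factor at each step and moves by at most its square
    root ([energy_descent]), hence converges to a triple of zero energy, close
    to the starting point ([invariant_triple]).  In a triple of zero energy
    all words of X carry v1 to v0, and comparing words that differ only near
    their ends produces a vector fixed by every generator
    ([invariant_of_blocks]).

    Spread of the triangles is a statement on the quadratic form attached to
    the random 3-uniform hypergraph on three copies of X: its distance to its
    mean must be at most a small multiple of D.  Replacing the mean by an
    independent copy, one bounds a high power of a matrix with symmetric
    distribution.  Only the walks using each random term at least twice
    survive ([walk_pair_cancel]), and those are few: a step reusing a term
    has boundedly many choices and a step with a new term about D
    ([walks_weighted]).  A walk of length 2P thus has at most P
    factors D, against D ^ (2P) in Markov's inequality; the loss of a power
    of the number of vertices is compensated by a large fixed P, because D is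
    itself a positive power of b ^ k ([bad_samples_le]).

    The computation is done for independent samples; [sample_to_subset]
    transfers the lower bound to uniform subsets, because adding relators
    preserves the existence of a good sample among them. *)

Set Implicit Arguments.
Unset Strict Implicit.
Unset Printing Implicit Defensive.
Import Order.TTheory GRing.Theory Num.Theory.
Import numFieldNormedType.Exports.
Local Open Scope ring_scope.

(** * From independent samples to uniform subsets *)

Section Coupling.
Variables (R : realType) (S : finType) (m : nat).
Local Notation sample := {ffun 'I_m -> S}.
Implicit Types (r : sample) (U : {set S}).

Definition range_of (T : finType) (r : {ffun 'I_m -> T}) : {set T} :=
  [set r i | i : 'I_m]%SET.

Lemma range_subP r U : reflect (forall i, r i \in U) (range_of r \subset U).
Proof.
apply: (iffP fintype.subsetP) => [h i|h x /imsetP[i _ ->] //].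
by apply: h; apply/imsetP; exists i.
Qed.

Definition supersets r : {set {set S}} :=
  [set U : {set S} | (#|U| == m) && (range_of r \subset U)]%SET.

Lemma card_supersets r :
  #|supersets r| = 'C(#|S| - #|range_of r|, m - #|range_of r|).
Proof.
set A := range_of r; have Am : (#|A| <= m)%N.
  by rewrite (leq_trans (leq_imset_card _ _)) // cardT size_enum_ord.
have -> : (#|S| - #|A| = #|~: A|)%N by rewrite -(cardsC A) addKn.
rewrite -cards_draws -(@card_in_imset _ _ (fun B => A :|: B)); last first.
  move=> B1 B2; rewrite !finset.inE => /andP[B1A _] /andP[B2A _] e.
  have h (B : {set S}) : B \subset ~: A -> (A :|: B) :\: A = B.
    by move=> BA; rewrite finset.setDUl finset.setDv finset.set0U finset.setDE; apply/finset.setIidPl.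
  by rewrite -(h _ B1A) e h.
apply: eq_card => U; apply/idP/imsetP => [|[B]].
  rewrite finset.inE => /andP[/eqP Um AU]; exists (U :\: A).
    rewrite finset.inE cardsD (finset.setIidPr AU) Um eqxx andbT.
    by apply/fintype.subsetP => x; rewrite !finset.inE => /andP[].
  by rewrite -{1}[U](finset.setID U A) (finset.setIidPr AU).
rewrite !finset.inE => /andP[BA /eqP Bm] ->.
rewrite finset.subsetUl andbT cardsU Bm (_ : A :&: B = finset.set0) ?cards0.
  by rewrite subn0 subnKC.
by apply/eqP; rewrite setI_eq0 disjoint_sym finset.disjoints_subset.
Qed.

Hypothesis mS : (m <= #|S|)%N.

(** The inverse of the number of m-subsets containing a given set of size k:
    a sample of range of size k is completed to a uniform m-subset. *)
Definition weight_of_card k : R :=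
  ('C(#|S| - k, m - k))%:R^-1.

(** The total weight received by an m-subset does not depend on the subset,
    since a bijection with the index set identifies its samples with the
    self-maps of the index set. *)
Lemma weight_sum U : #|U| = m ->
  \sum_(r : sample | range_of r \subset U) weight_of_card #|range_of r| =
  \sum_(t : {ffun 'I_m -> 'I_m}) weight_of_card #|range_of t|.
Proof.
move=> Um; pose e (i : 'I_m) : S := enum_val (cast_ord (esym Um) i).
have e_inj : injective e by move=> i k /enum_val_inj /cast_ord_inj.
pose h (t : {ffun 'I_m -> 'I_m}) : sample := [ffun i => e (t i)].
(* the default value i is never reached when the range of r lies in U *)
pose h' r : {ffun 'I_m -> 'I_m} := [ffun i => odflt i [pick k | e k == r i]].
rewrite (reindex_onto h h') /=; last first.
  move=> r /range_subP rU; apply/ffunP => i; rewrite !ffunE.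
  case: pickP => [k /eqP //|] /(_ (cast_ord Um (enum_rank_in (rU i) (r i)))).
  by rewrite /e cast_ordK enum_rankK_in ?eqxx.
apply: eq_big => [t|t _].
  have -> : range_of (h t) \subset U.
    by apply/range_subP => i; rewrite ffunE; exact: enum_valP.
  apply/eqP/ffunP => i; rewrite !ffunE; case: pickP => [k /eqP/e_inj //|].
  by move=> /(_ (t i)); rewrite eqxx.
congr weight_of_card; rewrite -(card_imset (mem (range_of t)) e_inj).
apply: eq_card => x; apply/imsetP/imsetP => [[i _ ->]|[k /imsetP[i _ ->] ->]].
  by exists (t i); rewrite ?ffunE // imset_f.
by exists i; rewrite ?ffunE.
Qed.

(** Choosing an independent sample and then a uniform m-subset containing its
    range yields a uniform m-subset, by [weight_sum]; this subset contains a
    good sample whenever the one first chosen is good. *)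
Lemma sample_to_subset (good : pred sample) :
  #|[set r | good r]%SET|%:R / #|S|%:R ^+ m <=
  #|[set U : {set S} | (#|U| == m) &&
      [exists r, good r && (range_of r \subset U)]]%SET|%:R / ('C(#|S|, m))%:R :> R.
Proof.
set Ok := [set U : {set S} | _]%SET.
set W := \sum_(t : {ffun 'I_m -> 'I_m}) weight_of_card #|range_of t|.
have w_gt0 r : 0 < (#|supersets r|)%:R :> R.
  by rewrite ltr0n card_supersets bin_gt0 leq_sub2r.
have wE r : weight_of_card #|range_of r| = (#|supersets r|)%:R^-1.
  by rewrite card_supersets.
have total : ('C(#|S|, m))%:R * W = #|S|%:R ^+ m.
  rewrite -card_draws mulr_natl -sumr_const.
  rewrite (eq_bigr (fun U => \sum_(r : sample | range_of r \subset U) weight_of_card #|range_of r|)); last first.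
    by move=> U; rewrite finset.inE => /eqP Um; rewrite weight_sum.
  rewrite (exchange_big_dep xpredT) //=.
  rewrite (eq_bigr (fun=> 1)) => [|r _].
    by rewrite sumr_const card_ffun card_ord natrX.
  rewrite sumr_const wE -[LHS]mulr_natl.
  rewrite (_ : #|_| = #|supersets r|); first by rewrite mulfV ?gt_eqF.
  by apply: eq_card => U; rewrite unfold_in !finset.inE.
have C0 : 0 < ('C(#|S|, m))%:R :> R by rewrite ltr0n bin_gt0.
have key : #|[set r | good r]%SET|%:R <= #|Ok|%:R * W.
  rewrite -[X in X <= _]mulr1 mulr_natl -sumr_const.
  apply: (@le_trans _ _ (\sum_(r in [set r | good r]%SET) \sum_(U in Ok | range_of r \subset U) weight_of_card #|range_of r|)).
    apply: ler_sum => r; rewrite finset.inE => gr.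
    rewrite sumr_const wE -[X in _ <= X]mulr_natl (_ : #|_| = #|supersets r|).
      by rewrite mulfV ?gt_eqF.
    apply: eq_card => U; rewrite unfold_in !finset.inE -andbA; congr (_ && _).
    by apply/andP/idP => [[]//|rU]; split=> //; apply/existsP; exists r; rewrite gr.
  rewrite (exchange_big_dep (mem Ok)) /=; last by move=> r U _ /andP[].
  rewrite mulr_natl -sumr_const; apply: ler_sum => U UOk.
  move: (UOk); rewrite finset.inE => /andP[/eqP Um _].
  rewrite /W -(weight_sum Um) [X in _ <= X](bigID good) /=.
  rewrite [X in X <= _](eq_bigl (fun r => (range_of r \subset U) && good r)).
    by rewrite lerDl sumr_ge0 // => r _; rewrite invr_ge0.
  move=> r; move: UOk; rewrite !finset.inE => -> /=; exact: andbC.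
have M1 : 0 < #|S|%:R ^+ m :> R.
  case: m mS => [|k] kS; first by rewrite expr0.
  by rewrite exprn_gt0 // ltr0n (leq_trans _ kS).
by rewrite ler_pdivrMr // mulrAC ler_pdivlMr // -total mulrCA mulrC ler_pM2l.
Qed.
End Coupling.

(** * Walks with few distinct steps *)

Lemma big_tupleS (R : Type) (idx : R) (op : Monoid.com_law idx) (I : finType)
    n (F : n.+1.-tuple I -> R) :
  \big[op/idx]_(s : n.+1.-tuple I) F s =
  \big[op/idx]_i \big[op/idx]_(s : n.-tuple I) F [tuple of i :: s].
Proof.
rewrite pair_big /= (reindex (fun p : I * n.-tuple I => [tuple of p.1 :: p.2])) //=.
exists (fun s : n.+1.-tuple I => (thead s, [tuple of behead s])) => [[i s] _|s _] /=.
  by congr pair; apply: val_inj.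
by rewrite [RHS]tuple_eta; apply: val_inj.
Qed.

(** A family of matrices B i is regarded as a set of labelled steps; [walk B s]
    is the product of the B i along s, whose entries sum over the vertex
    paths with labels s. *)
Section Walks.
Variables (R : realType) (V I : finType).
Implicit Types (B C : I -> V -> V -> R) (s : seq I).

Fixpoint walk B s (v w : V) : R :=
  if s is i :: s' then \sum_u B i v u * walk B s' u w else (v == w)%:R.

Fixpoint mpow (X : V -> V -> R) n (v w : V) : R :=
  if n is n'.+1 then \sum_u X v u * mpow X n' u w else (v == w)%:R.

Lemma mpow_sum B n v w :
  mpow (fun v w => \sum_i B i v w) n v w = \sum_(s : n.-tuple I) walk B s v w.
Proof.
elim: n v => [|n IHn] v /=.
  rewrite (bigD1 [tuple]) //= big1 ?addr0 // => s /eqP[]; exact: tuple0.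
rewrite big_tupleS /=; under [RHS]eq_bigr => i _ do rewrite exchange_big /=.
rewrite [RHS]exchange_big /=; apply: eq_bigr => u _.
by rewrite IHn mulr_suml; apply: eq_bigr => i _; rewrite mulr_sumr.
Qed.

Lemma walk_ge0 C s v w : (forall i v w, 0 <= C i v w) -> 0 <= walk C s v w.
Proof.
move=> C0; elim: s v => [|i s IHs] v /=; first by rewrite ler0n.
by apply: sumr_ge0 => u _; rewrite mulr_ge0.
Qed.

Lemma walk_norm B C s v w : (forall i v w, `|B i v w| <= C i v w) ->
  `|walk B s v w| <= walk C s v w.
Proof.
move=> BC; elim: s v => [|i s IHs] v /=; first by rewrite ger0_norm ?ler0n.
apply: le_trans (ler_norm_sum _ _ _) _; apply: ler_sum => u _.
by rewrite normrM ler_pM.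
Qed.

Definition walks_from C s v := \sum_w walk C s v w.

Lemma walks_from_cons C i s v :
  walks_from C (i :: s) v = \sum_u C i v u * walks_from C s u.
Proof.
rewrite /walks_from /= exchange_big /=.
by apply: eq_bigr => u _; rewrite big_distrr.
Qed.

Lemma walks_from_ge0 C s v : (forall i v w, 0 <= C i v w) ->
  0 <= walks_from C s v.
Proof. by move=> C0; apply: sumr_ge0 => w _; exact: walk_ge0. Qed.

Section Count.
Variables (C : I -> V -> V -> R) (c D : R).
Hypothesis c0 : 0 <= c.
Hypothesis C0 : forall i v w, 0 <= C i v w.
Hypothesis Cc : forall i v, \sum_w C i v w <= c.
Hypothesis D1 : 1 <= D.
Hypothesis CD : forall v, \sum_i \sum_w C i v w <= D.

Let setUs (U : {set I}) s : {set I} := U :|: [set i in s].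

(** Discounting each new label by the factor D makes the number of walks grow
    only by a constant per step: a label already in U is one of at most q,
    each of row sum at most c, and the new labels together have row sum at
    most D, which the discount cancels. *)
Lemma walks_weighted (q n : nat) (U : {set I}) v : (#|U| + n <= q)%N ->
  \sum_(s : n.-tuple I) D ^+ #|U| / D ^+ #|setUs U s| * walks_from C s v
    <= (q%:R * c + 1) ^+ n.
Proof.
have D0 : 0 < D by apply: lt_le_trans D1.
elim: n U v => [|n IHn] U v Un.
  rewrite expr0 (bigD1 [tuple]) //= big1 ?addr0; last first.
    by move=> s /eqP[]; exact: tuple0.
  have -> : setUs U [::] = U by apply/setP=> i; rewrite !inE orbF.
  rewrite divff ?expf_neq0 ?gt_eqF // mul1r /walks_from /= (bigD1 v) //= eqxx.
  by rewrite big1 ?addr0 // => w /negPf; rewrite eq_sym => ->.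
set K := q%:R * c + 1.
have K0 : 0 <= K by rewrite addr_ge0 ?mulr_ge0.
rewrite big_tupleS /= (bigID (mem U)) /= exprS {1}/K mulrDl mul1r.
apply: lerD.
  (* a repeated index: at most q choices, each contributing at most c *)
  apply: (@le_trans _ _ (\sum_(i in U) c * K ^+ n)); last first.
    rewrite sumr_const -[leLHS]mulr_natl mulrA ler_wpM2r ?exprn_ge0 //.
    by rewrite ler_wpM2r // ler_nat (leq_trans _ Un) ?leq_addr.
  apply: ler_sum => i iU.
  under eq_bigr => s _ do rewrite walks_from_cons mulr_sumr.
  rewrite exchange_big /= (le_trans _ (ler_wpM2r (exprn_ge0 n K0) (Cc i v))) //.
  rewrite mulr_suml; apply: ler_sum => u _.
  have := IHn U u (leq_trans (leq_add (leqnn _) (leqnSn n)) Un).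
  move=> /(ler_wpM2l (C0 i v u)); apply: le_trans.
  rewrite mulr_sumr; apply: ler_sum => s _.
  have -> : setUs U (i :: s) = setUs U s.
    by apply/setP=> j; rewrite !inE; case: eqP => // ->; rewrite iU.
  by rewrite mulrCA.
(* a new index: the total weight of the edges at v is at most D *)
apply: (@le_trans _ _ (\sum_(i | i \notin U) (\sum_u C i v u) / D * K ^+ n)).
  apply: ler_sum => i iU.
  under eq_bigr => s _ do rewrite walks_from_cons mulr_sumr.
  rewrite exchange_big /= !mulr_suml; apply: ler_sum => u _.
  have Ui : #|i |: U| = #|U|.+1 by rewrite cardsU1 iU.
  have := IHn (i |: U) u; rewrite Ui addSnnS => /(_ Un).
  have CD0 : 0 <= C i v u / D by rewrite divr_ge0 ?C0 ?(ltW D0).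
  move=> /(ler_wpM2l CD0); apply: le_trans.
  rewrite mulr_sumr; apply: ler_sum => s _.
  have -> : setUs U (i :: s) = setUs (i |: U) s.
    by apply/setP=> j; rewrite !inE; case: eqP => //= ->; rewrite orbT.
  rewrite exprS le_eqVlt; apply/orP; left; apply/eqP.
  by field; rewrite expf_neq0 gt_eqF.
rewrite -mulr_suml -[leRHS]mul1r ler_wpM2r ?exprn_ge0 // -mulr_suml.
rewrite ler_pdivrMr // mul1r (le_trans _ (CD v)) // [leRHS](bigID (mem U)) /=.
by rewrite lerDr; apply: sumr_ge0 => i _; apply: sumr_ge0.
Qed.

(** The pairs (s, t) are closed walks of length 2P; applying
    [walks_weighted] to t with U the labels of s and then to s leaves a factor
    D for each of the at most P distinct labels. *)
Lemma walk_pairs_le (P : nat) v :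
  \sum_(s : P.-tuple I) \sum_(t : P.-tuple I | (#|[set i in s ++ t]%SET| <= P)%N)
     \sum_w walk C s v w * walk C t v w
   <= ((2 * P)%:R * c + 1) ^+ (2 * P) * D ^+ P.
Proof.
have D0 : 0 < D by apply: lt_le_trans D1.
set K := (2 * P)%:R * c + 1.
have K0 : 0 <= K by rewrite addr_ge0 ?mulr_ge0.
have step (s : P.-tuple I) :
    \sum_(t : P.-tuple I | (#|[set i in s ++ t]%SET| <= P)%N)
      \sum_w walk C s v w * walk C t v w
    <= (D ^+ #|[set i in s]%SET|)^-1 * walks_from C s v * (K ^+ P * D ^+ P).
  have sP : (#|[set i in s]%SET| + P <= 2 * P)%N.
    rewrite mul2n -addnn leq_add2r cardsE.
    by rewrite (leq_trans (card_size _)) ?size_tuple.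
  have := walks_weighted v sP; rewrite -/K => h.
  have {}h : \sum_(t : P.-tuple I) (D ^+ #|setUs [set i in s] t|)^-1 * walks_from C t v
     <= (D ^+ #|[set i in s]%SET|)^-1 * K ^+ P.
    rewrite ler_pdivlMl ?exprn_gt0 //.
    apply: le_trans h; rewrite mulr_sumr; apply: ler_sum => t _.
    by rewrite mulrA.
  apply: (@le_trans _ _ (walks_from C s v * D ^+ P * 
      \sum_(t : P.-tuple I) (D ^+ #|setUs [set i in s] t|)^-1 * walks_from C t v));
    last first.
    rewrite (_ : _ * (K ^+ P * _) = walks_from C s v * D ^+ P *
      ((D ^+ #|[set i in s]%SET|)^-1 * K ^+ P)); last by ring.
    by rewrite ler_wpM2l // mulr_ge0 ?walks_from_ge0 // exprn_ge0 ?(ltW D0).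
  rewrite mulr_sumr [X in X <= _]big_mkcond /=; apply: ler_sum => t _.
  have -> : setUs [set i in s] t = [set i in s ++ t]%SET.
    by apply/setP=> j; rewrite !inE mem_cat.
  have w0 : 0 <= walks_from C s v * walks_from C t v.
    by rewrite mulr_ge0 ?walks_from_ge0.
  case: ifP => [stP|_]; last first.
    by rewrite !mulr_ge0 ?walks_from_ge0 ?invr_ge0 ?exprn_ge0 ?(ltW D0).
  apply: (@le_trans _ _ (walks_from C s v * walks_from C t v)).
    rewrite /walks_from mulr_suml; apply: ler_sum => w _.
    apply: ler_wpM2l; first exact: walk_ge0.
    by rewrite (bigD1 w) //= lerDl; apply: sumr_ge0 => ? _; exact: walk_ge0.
  have Dle : 1 <= D ^+ P / D ^+ #|[set i in s ++ t]%SET|.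
    by rewrite ler_pdivlMr ?exprn_gt0 // mul1r ler_weXn2l.
  rewrite -[leLHS]mul1r; apply: le_trans (ler_wpM2r w0 Dle) _.
  by rewrite le_eqVlt; apply/orP; left; apply/eqP; ring.
apply: (@le_trans _ _ (\sum_(s : P.-tuple I)
   (D ^+ #|[set i in s]%SET|)^-1 * walks_from C s v * (K ^+ P * D ^+ P))).
  by apply: ler_sum => s _; exact: step.
rewrite -mulr_suml mul2n -addnn exprD mulrA ler_wpM2r ?exprn_ge0 ?(ltW D0) //.
rewrite ler_wpM2r ?exprn_ge0 //.
have P0 : (#|(finset.set0 : {set I})| + P <= 2 * P)%N by rewrite cards0 leq_pmull.
have := walks_weighted v P0; rewrite cards0 -/K; apply: le_trans.
by apply: ler_sum => s _; rewrite /setUs finset.set0U expr0 mul1r.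
Qed.

End Count.
End Walks.

(** * Moments of a symmetrized random matrix *)

Lemma size_sum_count (I : finType) (s : seq I) :
  (\sum_i count_mem i s)%N = size s.
Proof.
elim: s => [|j s IHs] /=; first by rewrite big1.
by rewrite big_split /= IHs (bigD1 j) //= eqxx big1 // => i /negPf; rewrite eq_sym => ->.
Qed.

Lemma exists_count1 (I : finType) (P : nat) (s : seq I) :
  (size s <= 2 * P)%N -> (P < #|[set i in s]%SET|)%N ->
  exists i, count_mem i s = 1%N.
Proof.
move=> sP Ps; case: (pickP (fun i => count_mem i s == 1%N)) => [i /eqP|s1].
  by exists i.
move: Ps; rewrite ltnNge -(@leq_pmul2l 2) // (leq_trans _ sP) // -size_sum_count.
rewrite mulnC -sum_nat_const [X in (X <= _)%N]big_mkcond leq_sum //= => i _; rewrite inE.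
case: ifP => // is_; have := s1 i; have : has (pred1 i) s by rewrite has_pred1.
by rewrite has_count; case: count => [|[|]].
Qed.

(** The random matrix is [total_mx om], a sum of m differences of two
    independent copies of a nonnegative random matrix A; [deg om v] bounds
    the row sum of its absolute values. *)
Section Moment.
Variables (R : realType) (V S : finType) (m : nat) (A : S -> V -> V -> R).
Notation pairs := {ffun 'I_m -> S * S}.
Implicit Types (om : pairs).

Definition diff_mx om (i : 'I_m) v w := A (om i).1 v w - A (om i).2 v w.
Definition sum_mx om (i : 'I_m) v w := A (om i).1 v w + A (om i).2 v w.

Definition swap_at (i0 : 'I_m) om : pairs :=
  [ffun i => if i == i0 then ((om i).2, (om i).1) else om i].

Lemma swap_atK i0 : involutive (swap_at i0).
Proof.
by move=> om; apply/ffunP => i; rewrite !ffunE; case: eqP => //; case: (om i).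
Qed.

Lemma walk_swap i0 om s v w :
  walk (diff_mx (swap_at i0 om)) s v w =
  (-1) ^+ count_mem i0 s * walk (diff_mx om) s v w.
Proof.
elim: s v => [|i s IHs] v /=; first by rewrite mul1r.
rewrite mulr_sumr; apply: eq_bigr => u _; rewrite IHs /diff_mx ffunE exprD.
by case: eqP => [->|_] /=; rewrite ?expr1 ?expr0; ring.
Qed.

(** Exchanging the two copies at the index i0 preserves the uniform law and
    changes the sign of the summand. *)
Lemma walk_pair_cancel (s t : seq 'I_m) i0 v w : count_mem i0 (s ++ t) = 1%N ->
  \sum_om walk (diff_mx om) s v w * walk (diff_mx om) t v w = 0.
Proof.
rewrite count_cat => st; set F := \sum_om _.
suff FN : F = - F by apply/eqP; rewrite -[F == 0](@mulrn_eq0 R _ 2) mulr2n {1}FN addNr.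
rewrite {1}/F (reindex_inj (inv_inj (swap_atK i0))) /= -sumrN.
apply: eq_bigr => om _; rewrite !walk_swap mulrACA -exprD st expr1.
by rewrite mulN1r.
Qed.

Definition deg om v := \sum_i \sum_w sum_mx om i v w.

Definition total_mx om v w := \sum_i diff_mx om i v w.

Definition maxdeg om := \big[Num.max/1]_v deg om v.

Variable c : R.
Hypothesis A0 : forall x v w, 0 <= A x v w.
Hypothesis Ac : forall x v, \sum_w A x v w <= c.
Hypothesis c0 : 0 <= c.

Let sum0 om i v w : 0 <= sum_mx om i v w. Proof. by rewrite addr_ge0. Qed.

Lemma deg_ge0 om v : 0 <= deg om v.
Proof. by apply: sumr_ge0 => i _; apply: sumr_ge0. Qed.

(** In the expansion over pairs of label sequences, a sequence of length 2P
    with more than P labels has a label occurring once, so its contribution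
    vanishes; the others are counted by [walk_pairs_le]. *)
Lemma walk_moment (P : nat) :
  \sum_om \sum_v \sum_w mpow (total_mx om) P v w ^+ 2
   <= ((2 * P)%:R * (2 * c) + 1) ^+ (2 * P) * #|V|%:R * \sum_om maxdeg om ^+ P.
Proof.
set K := _ ^+ (2 * P).
have Heq : \sum_om \sum_v \sum_w mpow (total_mx om) P v w ^+ 2 =
  \sum_v \sum_w \sum_(s : P.-tuple 'I_m) \sum_(t : P.-tuple 'I_m)
    \sum_om walk (diff_mx om) s v w * walk (diff_mx om) t v w.
  rewrite exchange_big /=; apply: eq_bigr => v _.
  rewrite exchange_big /=; apply: eq_bigr => w _.
  transitivity (\sum_om \sum_(s : P.-tuple 'I_m) \sum_(t : P.-tuple 'I_m)
     walk (diff_mx om) s v w * walk (diff_mx om) t v w).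
    apply: eq_bigr => om _; rewrite /total_mx mpow_sum expr2 mulr_suml.
    by apply: eq_bigr => s _; rewrite mulr_sumr.
  rewrite exchange_big /=; apply: eq_bigr => s _; exact: exchange_big.
rewrite {}Heq.
apply: (@le_trans _ _ (\sum_v \sum_w \sum_(s : P.-tuple 'I_m)
    \sum_(t : P.-tuple 'I_m | (#|[set i in s ++ t]%SET| <= P)%N)
    \sum_om walk (sum_mx om) s v w * walk (sum_mx om) t v w)).
  do 3 (apply: ler_sum => ? _); rewrite [leRHS]big_mkcond /=.
  apply: ler_sum => t _; case: ifPn => [_|].
    apply: ler_sum => om _; apply: le_trans (ler_norm _) _; rewrite normrM.
    apply: ler_pM => //; apply: walk_norm => i v' w';
      by apply: le_trans (ler_normB _ _) _; rewrite !ger0_norm.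
  rewrite -ltnNge => /exists_count1[|i /walk_pair_cancel -> //].
  by rewrite size_cat !size_tuple addnn mul2n.
rewrite -mulrA mulr_sumr mulr_sumr.
under eq_bigr => v _ do under eq_bigr => w _ do
  under eq_bigr => s _ do rewrite exchange_big /=.
under eq_bigr => v _ do under eq_bigr => w _ do rewrite exchange_big /=.
under eq_bigr => v _ do rewrite exchange_big /=.
rewrite exchange_big /=; apply: ler_sum => om _.
rewrite mulrCA mulr_natl -sumr_const; apply: ler_sum => v _.
rewrite exchange_big /=; under eq_bigr => s _ do rewrite exchange_big /=.
apply: walk_pairs_le => //.
- by rewrite mulr_ge0.
- by move=> i u; rewrite /sum_mx big_split /= mulrDl mul1r lerD.
- by rewrite /maxdeg bigmax_idl le_max lexx.
- by move=> u; rewrite -/(deg om u) /maxdeg (bigmaxD1 u) //= le_max lexx.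
Qed.

(** Bounding a maximum by a sum costs one factor #|V|, which is harmless
    because the exponent P will be large. *)
Lemma maxdeg_exp (P : nat) om : maxdeg om ^+ P <= 1 + \sum_v deg om v ^+ P.
Proof.
have d0 v : 0 <= deg om v ^+ P by rewrite exprn_ge0 // deg_ge0.
have s0 (Q : pred V) : 0 <= \sum_(v | Q v) deg om v ^+ P by apply: sumr_ge0.
rewrite /maxdeg; elim/big_ind: _ => [|x y hx hy|v _].
- by rewrite expr1n lerDl.
- by case: (leP x y).
- by rewrite (bigD1 v) //= addrCA lerDl addr_ge0.
Qed.

Variables (D a : R).
Hypothesis m0 : (0 < m)%N.
Hypothesis D0 : 0 < D.
Hypothesis cD : 4 * c <= D.
Hypothesis AD : forall v, m%:R * (\sum_x \sum_w A x v w) <= a * D * #|S|%:R.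

Lemma expR_le_1D2x (x : R) : 0 <= x <= 1 / 2 -> expR x <= 1 + 2 * x.
Proof.
move=> /andP[x0 x1]; have y0 : 0 < 1 - x by lra.
have := expR_ge1Dx (- x); rewrite expRN => h.
rewrite -[leLHS]invrK (@le_trans _ _ (1 - x)^-1) //.
  by rewrite lef_pV2 ?posrE ?invr_gt0 ?expR_gt0.
by rewrite -div1r ler_pdivrMr //; nra.
Qed.

(** This is (x / P) ^ P <= exp (x / P) ^ P. *)
Lemma exprn_le_expR (P : nat) (x : R) : 0 <= x -> x ^+ P <= P%:R ^+ P * expR x.
Proof.
case: P => [|P] x0; first by rewrite !expr0 mul1r -expR0 ler_expR.
have P0 : 0 < P.+1%:R :> R by rewrite ltr0n.
rewrite -ler_pdivrMl ?exprn_gt0 // mulrC -exprVn -exprMn.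
rewrite (_ : expR x = expR (x / P.+1%:R) ^+ P.+1); last first.
  by rewrite -expRM_natl; congr expR; field.
rewrite lerXn2r ?nnegrE ?divr_ge0 ?expR_ge0 //.
by apply: le_trans (expR_ge1Dx _); rewrite lerDr.
Qed.

(** The exponential of a sum of independent terms has a product as its mean,
    and the mean of each factor is at most 1 + 4 a / m. *)
Lemma deg_exp_moment v :
  \sum_om expR (deg om v / D) <= #|S|%:R ^+ (2 * m) * expR (4 * a).
Proof.
pose d x := \sum_w A x v w.
have d0 x : 0 <= d x by apply: sumr_ge0.
have Heq om : expR (deg om v / D) = \prod_i expR ((d (om i).1 + d (om i).2) / D).
  rewrite -expR_sum -mulr_suml; congr (expR (_ / D)).
  by apply: eq_bigr => i _; rewrite /sum_mx big_split.
under eq_bigr => om _ do rewrite Heq.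
rewrite -(bigA_distr_bigA (fun _ (p : S * S) => expR ((d p.1 + d p.2) / D))) /=.
rewrite prodr_const card_ord exprM.
have -> : expR (4 * a) = expR (4 * a / m%:R) ^+ m.
  by rewrite -expRM_natl; congr expR; field; rewrite pnatr_eq0 -lt0n.
rewrite -exprMn lerXn2r ?nnegrE ?mulr_ge0 ?exprn_ge0 ?expR_ge0 ?sumr_ge0 //.
apply: (@le_trans _ _ (\sum_(p : S * S) (1 + 2 * ((d p.1 + d p.2) / D)))).
  apply: ler_sum => p _; apply: expR_le_1D2x.
  rewrite divr_ge0 ?addr_ge0 ?(ltW D0) //= ler_pdivrMr //.
  have h1 : d p.1 <= c := Ac _ _; have h2 : d p.2 <= c := Ac _ _.
  clear Heq; have h3 := cD; move: h1 h2 h3; move: (d p.1) (d p.2) => x y; lra.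
rewrite big_split /= sumr_const card_prod -mulr_sumr -mulr_suml big_split /=.
rewrite -(pair_bigA _ (fun x y => d x)) -(pair_bigA _ (fun x y => d y)) /=.
under eq_bigr => x _ do rewrite sumr_const.
rewrite sumr_const sumrMnl /=.
have AD' : m%:R * (\sum_x d x) <= a * D * #|S|%:R by exact: AD.
have m0' : 0 < m%:R :> R by rewrite ltr0n.
apply: (@le_trans _ _ (#|S|%:R ^+ 2 * (1 + 4 * a / m%:R))); last first.
  by rewrite ler_wpM2l ?exprn_ge0 ?expR_ge1Dx.
set s := \sum_x d x in AD' *.
rewrite -mulr_natl natrM -(mulr_natl s).
have : s / D <= a * #|S|%:R / m%:R.
  by rewrite ler_pdivrMr // mulrAC ler_pdivlMr // mulrC mulrAC.
have S0 : 0 <= #|S|%:R :> R by [].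
move=> /(ler_wpM2l S0) h.
have -> : #|S|%:R * #|S|%:R + 2 * 1 * ((#|S|%:R * s + #|S|%:R * s) / D) =
  #|S|%:R ^+ 2 + 4 * (#|S|%:R * (s / D)) by ring.
have -> : #|S|%:R ^+ 2 * (1 + 4 * a / m%:R) =
  #|S|%:R ^+ 2 + 4 * (#|S|%:R * (a * #|S|%:R / m%:R)) by ring.
by rewrite lerD2l ler_pM2l.
Qed.

Lemma deg_moment (P : nat) v :
  \sum_om deg om v ^+ P <= #|S|%:R ^+ (2 * m) * (P%:R ^+ P * expR (4 * a) * D ^+ P).
Proof.
apply: (@le_trans _ _ (\sum_om P%:R ^+ P * D ^+ P * expR (deg om v / D))).
  apply: ler_sum => om _.
  have /(exprn_le_expR P) : 0 <= deg om v / D by rewrite divr_ge0 ?deg_ge0 ?(ltW D0).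
  by rewrite exprMn exprVn ler_pdivrMr ?exprn_gt0 // mulrAC.
rewrite -mulr_sumr.
have /(ler_wpM2l) : 0 <= P%:R ^+ P * D ^+ P by rewrite mulr_ge0 ?exprn_ge0 ?(ltW D0).
move=> /(_ _ _ (deg_exp_moment v)) => h; apply: le_trans h _.
by rewrite le_eqVlt; apply/orP; left; apply/eqP; ring.
Qed.

Lemma matrix_moment (P : nat) :
  \sum_om \sum_v \sum_w mpow (total_mx om) P v w ^+ 2
   <= #|S|%:R ^+ (2 * m) * (((2 * P)%:R * (2 * c) + 1) ^+ (2 * P) * #|V|%:R *
      (1 + #|V|%:R * (P%:R ^+ P * expR (4 * a)) * D ^+ P)).
Proof.
apply: le_trans (walk_moment P) _; rewrite [leRHS]mulrCA; apply: ler_wpM2l.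
  by rewrite mulr_ge0 ?exprn_ge0 ?addr_ge0 ?mulr_ge0.
apply: (@le_trans _ _ (\sum_om (1 + \sum_v deg om v ^+ P))).
  by apply: ler_sum => om _; exact: maxdeg_exp.
rewrite big_split /= sumr_const card_ffun card_ord card_prod natrX natrM.
rewrite mulrDr mulr1 -expr2 -exprM lerD2l exchange_big /=.
apply: (@le_trans _ _ (\sum_(v : V) #|S|%:R ^+ (2 * m) * (P%:R ^+ P * expR (4 * a) * D ^+ P))).
  by apply: ler_sum => v _; exact: deg_moment.
rewrite sumr_const -[leLHS]mulr_natl le_eqVlt; apply/orP; left; apply/eqP; ring.
Qed.
End Moment.

(** * Quadratic forms over a real inner product space *)

(** A property of a bare function, so that it can be instantiated both at the
    real part of a complex inner product and at its sum over finitely many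
    copies of the space. *)
Record real_inner (R : realType) (H : lmodType R) (dot : H -> H -> R) : Prop :=
  RealInner {
    dotC : forall u v, dot u v = dot v u;
    dotDl : forall u v w, dot (u + v) w = dot u w + dot v w;
    dotZl : forall a u w, dot (a *: u) w = a * dot u w;
    dot_ge0 : forall u, 0 <= dot u u }.

Section RealInner.
Variables (R : realType) (H : lmodType R) (dot : H -> H -> R).
Hypothesis ip : real_inner dot.
Implicit Types (u v w : H).

Lemma dotDr u v w : dot u (v + w) = dot u v + dot u w.
Proof. by rewrite !(dotC ip u) (dotDl ip). Qed.
Lemma dotZr a u v : dot u (a *: v) = a * dot u v.
Proof. by rewrite !(dotC ip u) (dotZl ip). Qed.
Lemma dot0l w : dot 0 w = 0.
Proof. by rewrite -(scale0r 0) (dotZl ip) mul0r. Qed.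
Lemma dot0r w : dot w 0 = 0. Proof. by rewrite (dotC ip) dot0l. Qed.
Lemma dotNl u w : dot (- u) w = - dot u w.
Proof. by rewrite -scaleN1r (dotZl ip) mulN1r. Qed.
Lemma dotNr u w : dot u (- w) = - dot u w.
Proof. by rewrite -scaleN1r dotZr mulN1r. Qed.
Lemma dot_suml (I : Type) (r : seq I) (P : pred I) (F : I -> H) w :
  dot (\sum_(i <- r | P i) F i) w = \sum_(i <- r | P i) dot (F i) w.
Proof. by apply: (big_morph (dot^~ w)) => [u v|]; rewrite ?(dotDl ip) ?dot0l. Qed.
Lemma dot_sumr (I : Type) (r : seq I) (P : pred I) (F : I -> H) w :
  dot w (\sum_(i <- r | P i) F i) = \sum_(i <- r | P i) dot w (F i).
Proof. by apply: (big_morph (dot w)) => [u v|]; rewrite ?dotDr ?dot0r. Qed.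

Lemma dot_sqrD u v : dot (u + v) (u + v) = dot u u + 2 * dot u v + dot v v.
Proof. by rewrite (dotDl ip) !dotDr (dotC ip v u); ring. Qed.
Lemma dot_sqrB u v : dot (u - v) (u - v) = dot u u - 2 * dot u v + dot v v.
Proof. by rewrite dot_sqrD !dotNr dotNl; ring. Qed.
Lemma dot_sqrZ a u : dot (a *: u) (a *: u) = a ^+ 2 * dot u u.
Proof. by rewrite (dotZl ip) dotZr; ring. Qed.

Lemma dot_CauchySchwarz u v : dot u v ^+ 2 <= dot u u * dot v v.
Proof.
have := dot_ge0 ip (dot v v *: u - dot u v *: v).
rewrite dot_sqrB !dot_sqrZ (dotZl ip) dotZr.
have := dot_ge0 ip v; rewrite le_eqVlt => /orP[/eqP v0 _|v0].
  (* a null vector is orthogonal to everything *)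
  have [->|s0] := eqVneq (dot u v) 0; first by rewrite -v0 mulr0 expr0n.
  (* otherwise this multiple of v gives a vector of squared norm -1 *)
  have := dot_ge0 ip (u - ((1 + dot u u) / (2 * dot u v)) *: v).
  rewrite dot_sqrB dot_sqrZ dotZr -v0 mulr0 addr0.
  by rewrite (_ : _ - _ = -1) ?oppr_ge0 ?ler10 //; field.
rewrite (_ : _ + _ = dot v v * (dot u u * dot v v - dot u v ^+ 2)); last by ring.
by rewrite pmulr_rge0 // subr_ge0.
Qed.

(** Summing the squared norms of a w *: f v - a v *: f w over all pairs. *)
Lemma dot_comb_le (V : finType) (a : V -> R) (f : V -> H) :
  dot (\sum_v a v *: f v) (\sum_v a v *: f v) <=
  (\sum_v a v ^+ 2) * (\sum_v dot (f v) (f v)).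
Proof.
set u := \sum_v _.
have -> : dot u u = \sum_v \sum_w a v * a w * dot (f v) (f w).
  rewrite {1}/u dot_suml; apply: eq_bigr => v _; rewrite dot_sumr.
  by apply: eq_bigr => w _; rewrite (dotZl ip) dotZr mulrA.
have h : 2 * \sum_v \sum_w a v * a w * dot (f v) (f w) <=
   \sum_v \sum_w (a w ^+ 2 * dot (f v) (f v) + a v ^+ 2 * dot (f w) (f w)).
  rewrite mulr_sumr; apply: ler_sum => v _; rewrite mulr_sumr; apply: ler_sum => w _.
  have := dot_ge0 ip (a w *: f v - a v *: f w).
  rewrite dot_sqrB !dot_sqrZ (dotZl ip) dotZr; lra.
have e : \sum_v \sum_w (a w ^+ 2 * dot (f v) (f v) + a v ^+ 2 * dot (f w) (f w)) =
   2 * ((\sum_v a v ^+ 2) * (\sum_v dot (f v) (f v))).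
  under eq_bigr => v _ do rewrite big_split /= -mulr_suml -mulr_sumr.
  by rewrite big_split /= -mulr_sumr -mulr_suml; ring.
by move: h; rewrite e ler_pM2l.
Qed.

End RealInner.

Section MatrixAction.
Variables (R : realType) (H : lmodType R) (dot : H -> H -> R).
Hypothesis ip : real_inner dot.
Variable V : finType.
Implicit Types (f g : {ffun V -> H}) (X : V -> V -> R).

Definition dotF f g := \sum_v dot (f v) (g v).

Lemma dotF_inner : real_inner dotF.
Proof.
split=> [f g|f g h|a f g|f]; rewrite /dotF.
- by apply: eq_bigr => v _; rewrite (dotC ip).
- by rewrite -big_split; apply: eq_bigr => v _; rewrite ffunE (dotDl ip).
- by rewrite mulr_sumr; apply: eq_bigr => v _; rewrite ffunE (dotZl ip).
- by apply: sumr_ge0 => v _; exact: dot_ge0.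
Qed.
Let ipF := dotF_inner.

Definition mxact X f : {ffun V -> H} := [ffun v => \sum_w X v w *: f w].

Lemma mxact_id f : mxact (fun v w => (v == w)%:R) f = f.
Proof.
apply/ffunP => v; rewrite ffunE (bigD1 v) //= eqxx scale1r big1 ?addr0 // => w.
by rewrite eq_sym => /negPf->; rewrite scale0r.
Qed.

Lemma mxact_mul X Y f :
  mxact X (mxact Y f) = mxact (fun v w => \sum_u X v u * Y u w) f.
Proof.
apply/ffunP => v; rewrite !ffunE.
under eq_bigr => w _ do rewrite ffunE scaler_sumr.
rewrite exchange_big /=; apply: eq_bigr => w _.
by rewrite scaler_suml; apply: eq_bigr => u _; rewrite scalerA.
Qed.

Lemma mxact_mpow X n f : mxact (mpow X n) f = iter n (mxact X) f.
Proof. by elim: n f => [|n IHn] f /=; rewrite ?mxact_id // -IHn mxact_mul. Qed.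

Lemma mxact_sym X f g : (forall v w, X v w = X w v) ->
  dotF (mxact X f) g = dotF f (mxact X g).
Proof.
move=> Xs; rewrite /dotF.
under eq_bigr => v _ do rewrite ffunE (dot_suml ip).
rewrite exchange_big /=; apply: eq_bigr => w _.
rewrite ffunE (dot_sumr ip); apply: eq_bigr => v _.
by rewrite (dotZl ip) (dotZr ip) Xs.
Qed.

Lemma mxact_HS X f :
  dotF (mxact X f) (mxact X f) <= (\sum_v \sum_w X v w ^+ 2) * dotF f f.
Proof.
rewrite {1}/dotF mulr_suml; apply: ler_sum => v _; rewrite ffunE.
exact: (dot_comb_le ip).
Qed.

Lemma mxact_iter_sym X n f g : (forall v w, X v w = X w v) ->
  dotF (iter n (mxact X) f) g = dotF f (iter n (mxact X) g).
Proof.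
move=> Xs; elim: n g => //= n IHn g.
by rewrite mxact_sym // IHn -iterSr.
Qed.

(** Moments of a self-adjoint operator are log-convex: Cauchy-Schwarz applied
    to f and X ^ (2t) f doubles the exponent. *)
Lemma mxact_pow2_le X j f : (forall v w, X v w = X w v) ->
  dotF (mxact X f) (mxact X f) ^+ (2 ^ j) <=
  dotF f f ^+ (2 ^ j - 1) * dotF (iter (2 ^ j) (mxact X) f) (iter (2 ^ j) (mxact X) f).
Proof.
move=> Xs; set N := dotF f f.
have N0 : 0 <= N := dot_ge0 ipF f.
elim: j => [|j IHj]; first by rewrite expn0 subnn expr0 mul1r expr1.
set P := (2 ^ j)%N in IHj *.
have P0 : (0 < P)%N by rewrite expn_gt0.
rewrite expnS -/P mulnC exprM.
have -> : (P * 2 - 1 = (P - 1) * 2 + 1)%N by lia.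
set g := iter P _ f in IHj.
apply: (@le_trans _ _ ((N ^+ (P - 1) * dotF g g) ^+ 2)).
  by rewrite lerXn2r ?nnegrE ?mulr_ge0 ?exprn_ge0 ?(dot_ge0 ipF).
rewrite exprMn exprD expr1 exprM -mulrA ler_wpM2l ?exprn_ge0 //.
rewrite {1}/g mxact_iter_sym // /g -iterD addnn -muln2.
exact: (dot_CauchySchwarz ipF).
Qed.

(** The operator norm is at most the 2P-th root of the squared Hilbert-Schmidt
    norm of X ^ P.  This linear form of the bound, valid for any eta > 0, has no
    root and can be averaged over random X. *)
Lemma quadratic_form_le X j f eta : (forall v w, X v w = X w v) -> 0 < eta ->
  `|dotF f (mxact X f)| <=
  (eta + (\sum_v \sum_w mpow X (2 ^ j) v w ^+ 2) / eta ^+ (2 * 2 ^ j - 1)) * dotF f f.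
Proof.
move=> Xs e0; set P := (2 ^ j)%N; set S := \sum_v _; set rho := eta + _.
have P0 : (0 < P)%N by rewrite expn_gt0.
have S0 : 0 <= S by do 2 apply: sumr_ge0 => ? _; exact: sqr_ge0.
have eX : 0 < eta ^+ (2 * P - 1) by rewrite exprn_gt0.
have rho_eta : eta <= rho by rewrite lerDl divr_ge0 // ltW.
have rho0 : 0 < rho by apply: lt_le_trans rho_eta.
have rhoS : S <= rho ^+ (2 * P).
  rewrite (_ : 2 * P = 1 + (2 * P - 1))%N; last by lia.
  rewrite exprD expr1 -ler_pdivrMr ?exprn_gt0 // (@le_trans _ _ (S / eta ^+ (2 * P - 1))) //.
    by rewrite ler_wpM2l // lef_pV2 ?posrE ?exprn_gt0 // lerXn2r ?nnegrE // ltW.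
  by rewrite lerDr ltW.
have N0 : 0 <= dotF f f := dot_ge0 ipF f.
have NX0 : 0 <= dotF (mxact X f) (mxact X f) := dot_ge0 ipF _.
have key : dotF (mxact X f) (mxact X f) <= rho ^+ 2 * dotF f f.
  rewrite -(@ler_pXn2r _ P) ?nnegrE ?mulr_ge0 ?exprn_ge0 ?(ltW rho0) //.
  apply: le_trans (mxact_pow2_le j f Xs) _; rewrite -/P.
  rewrite -mxact_mpow exprMn -exprM.
  apply: le_trans (ler_wpM2l _ (mxact_HS _ _)) _; first by rewrite exprn_ge0.
  rewrite mulrCA -exprSr -subSn // subn1 /= ler_wpM2r ?exprn_ge0 //.
rewrite -ler_sqr ?nnegrE ?mulr_ge0 ?(ltW rho0) // real_normK ?num_real //.
apply: le_trans (dot_CauchySchwarz ipF _ _) _.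
by rewrite exprMn [X in _ <= _ * X]expr2 mulrA mulrC ler_wpM2r.
Qed.

End MatrixAction.

(** ** Concentration around the mean *)
Section Concentration.
Variables (R : realType) (V S : finType) (m : nat) (A : S -> V -> V -> R).
Variables (j : nat) (eta : R).
Local Notation P := (2 ^ j)%N.
Notation sample := {ffun 'I_m -> S}.
Implicit Types (r : sample).
Hypothesis eta0 : 0 < eta.
Hypothesis m0 : (0 < m)%N.
Hypothesis S0 : (0 < #|S|)%N.
Hypothesis Asym : forall x v w, A x v w = A x w v.

Definition pair_sample r r' : {ffun 'I_m -> S * S} := [ffun i => (r i, r' i)].

Definition hs_moment (om : {ffun 'I_m -> S * S}) : R :=
  \sum_v \sum_w mpow (total_mx A om) P v w ^+ 2.

(** For the fixed half r, the moment is averaged over the other half r'. *)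
Definition good_sample r :=
  \sum_(r' : sample) hs_moment (pair_sample r r') <= #|S|%:R ^+ m * eta ^+ (2 * P).

Lemma sum_sample (g : S -> R) (i : 'I_m) :
  #|S|%:R * \sum_(r : sample) g (r i) = #|S|%:R ^+ m * \sum_x g x.
Proof.
pose F (k : 'I_m) x := if k == i then g x else 1.
have -> : \sum_(r : sample) g (r i) = \sum_(r : sample) \prod_k F k (r k).
  apply: eq_bigr => r _; rewrite (bigD1 i) //= {1}/F eqxx big1 ?mulr1 // => k ki.
  by rewrite /F (negPf ki).
rewrite -(bigA_distr_bigA F) (bigD1 i) //= {1}/F eqxx.
have e k : k != i -> \sum_x F k x = #|S|%:R.
  by move=> ki; rewrite /F (negPf ki) sumr_const.
rewrite (eq_bigr _ e) prodr_const mulrCA -exprS cardC1 card_ord prednK //.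
by rewrite mulrC.
Qed.

Variables (H : lmodType R) (dot : H -> H -> R).
Hypothesis ip : real_inner dot.

(** The deviation of r from the mean is the average over r' of the difference
    between r and r', and each difference is bounded by
    [quadratic_form_le]. *)
Lemma good_sample_deviation r (f : {ffun V -> H}) : good_sample r ->
  `|\sum_i dotF dot f (mxact (A (r i)) f) -
    m%:R / #|S|%:R * \sum_x dotF dot f (mxact (A x) f)| <= 2 * eta * dotF dot f f.
Proof.
rewrite /good_sample => hr.
pose q x := dotF dot f (mxact (A x) f).
have M0 : 0 < #|S|%:R :> R by rewrite ltr0n.
have qX r' : dotF dot f (mxact (total_mx A (pair_sample r r')) f) =
    \sum_i q (r i) - \sum_i q (r' i).
  rewrite -sumrB.
  transitivity (\sum_i \sum_v \sum_w diff_mx A (pair_sample r r') i v w * dot (f v) (f w)).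
    rewrite exchange_big /= /dotF; apply: eq_bigr => v _.
    rewrite ffunE (dot_sumr ip) exchange_big /=; apply: eq_bigr => w _.
    by rewrite (dotZr ip) /total_mx mulr_suml.
  apply: eq_bigr => i _; rewrite /q /dotF -sumrB; apply: eq_bigr => v _.
  rewrite !ffunE !(dot_sumr ip) -sumrB; apply: eq_bigr => w _.
  by rewrite !(dotZr ip) /diff_mx ffunE /= mulrBl.
rewrite -(ler_pM2l (exprn_gt0 m M0)) -[X in X * `|_|](@ger0_norm _ (#|S|%:R ^+ m)) ?exprn_ge0 //.
rewrite -normrM.
have -> : #|S|%:R ^+ m * (\sum_i q (r i) - m%:R / #|S|%:R * \sum_x q x) =
   \sum_(r' : sample) dotF dot f (mxact (total_mx A (pair_sample r r')) f).
  under [RHS]eq_bigr => r' _ do rewrite qX.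
  rewrite sumrB sumr_const card_ffun card_ord mulrBr -[X in _ = X - _]mulr_natl natrX; congr (_ - _).
  have e i : \sum_(r' : sample) q (r' i) = #|S|%:R ^+ m * (\sum_x q x) / #|S|%:R.
    by rewrite -(sum_sample q i) mulrAC divff ?mul1r ?gt_eqF.
  rewrite [RHS]exchange_big /= (eq_bigr _ (fun i _ => e i)).
  by rewrite sumr_const card_ord -mulr_natr; ring.
apply: le_trans (ler_norm_sum _ _ _) _.
apply: (@le_trans _ _ (\sum_(r' : sample) (eta + hs_moment (pair_sample r r') / eta ^+ (2 * P - 1)) * dotF dot f f)).
  apply: ler_sum => r' _; apply: (quadratic_form_le ip) => // v w.
  by rewrite /total_mx /diff_mx; apply: eq_bigr => i _; rewrite Asym [X in _ - X]Asym.
rewrite -mulr_suml mulrA ler_wpM2r ?(dot_ge0 (dotF_inner ip V)) //.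
rewrite big_split /= sumr_const card_ffun card_ord -mulr_suml.
rewrite -[X in X + _]mulr_natl natrX.
rewrite mulrCA mulrDl mul1r lerD2l.
rewrite ler_pdivrMr ?exprn_gt0 // -mulrA -exprS.
by apply: le_trans hr _; rewrite -subSn ?muln_gt0 ?expn_gt0 // subn1.
Qed.

End Concentration.

Section BadSamples.
Variables (R : realType) (V S : finType) (m : nat) (A : S -> V -> V -> R).
Variables (j : nat) (c D a eta : R).
Local Notation P := (2 ^ j)%N.
Local Notation sample := {ffun 'I_m -> S}.

(** Markov's inequality for the moment computed in [matrix_moment]. *)
Lemma bad_samples_le :
  (0 < m)%N -> (0 < #|S|)%N -> 0 < eta -> 0 < D -> 0 <= c ->
  (forall x v w, 0 <= A x v w) ->
  (forall x v, \sum_w A x v w <= c) ->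
  4 * c <= D ->
  (forall v, m%:R * (\sum_x \sum_w A x v w) <= a * D * #|S|%:R) ->
  #|[set r : sample | ~~ `[< good_sample A j eta r >] ]|%:R * eta ^+ (2 * P) <=
  #|S|%:R ^+ m * (((2 * P)%:R * (2 * c) + 1) ^+ (2 * P) * #|V|%:R *
      (1 + #|V|%:R * (P%:R ^+ P * expR (4 * a)) * D ^+ P)).
Proof.
move=> m0 S0 eta0 D0 c0 A0 Ac cD AD.
have M0 : 0 < #|S|%:R ^+ m :> R by rewrite exprn_gt0 // ltr0n.
rewrite -(ler_pM2l M0) [X in _ <= X]mulrA -exprD addnn -mul2n.
apply: le_trans (matrix_moment A0 Ac c0 m0 D0 cD AD P).
have hs0 om : 0 <= hs_moment A j om.
  by do 2 apply: sumr_ge0 => ? _; exact: sqr_ge0.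
have -> : \sum_(om : {ffun 'I_m -> S * S}) \sum_v \sum_w mpow (total_mx A om) P v w ^+ 2 =
   \sum_(r : sample) \sum_(r' : sample) hs_moment A j (pair_sample r r').
  pose h (p : sample * sample) : {ffun 'I_m -> S * S} := pair_sample p.1 p.2.
  rewrite [RHS]pair_big /= (reindex h) //=.
  pose k (om : {ffun 'I_m -> S * S}) : sample * sample :=
    ([ffun i => (om i).1], [ffun i => (om i).2]).
  exists k => [[r r'] _|om _].
    by congr pair; apply/ffunP => i; rewrite !ffunE.
  by apply/ffunP => i; rewrite !ffunE; case: (om i).
rewrite [X in _ <= X](bigID (fun r : sample => `[< good_sample A j eta r >])) /=.
rewrite -[X in X <= _]add0r lerD ?sumr_ge0 //.
  by move=> r _; exact: sumr_ge0.
rewrite mulrCA mulr_natl -sumr_const.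
rewrite [X in X <= _](eq_bigl (fun r => ~~ `[< good_sample A j eta r >])); last first.
  by move=> r; rewrite /= finset.inE.
apply: ler_sum => r /asboolPn; rewrite /good_sample => /negP.
by rewrite -ltNge => /ltW.
Qed.
End BadSamples.

(** * Energy of a triple of vectors *)

Section Energy.
Variables (R : realType) (G : groupType) (H : lmodType R) (dot : H -> H -> R).
Variable rep : G -> H -> H.
Hypothesis ip : real_inner dot.
Hypothesis rep1 : forall u, rep 1%g u = u.
Hypothesis repM : forall g h u, rep (g * h)%g u = rep g (rep h u).
Hypothesis repD : forall g u v, rep g (u + v) = rep g u + rep g v.
Hypothesis repZ : forall g a u, rep g (a *: u) = a *: rep g u.
Hypothesis rep_dot : forall g u v, dot (rep g u) (rep g v) = dot u v.
Variable X : finType.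
Hypothesis X0 : (0 < #|X|)%N.
Local Notation N := (#|X|%:R : R).
Local Notation sq u := (dot u u).

Let N0 : 0 < N. Proof. by rewrite ltr0n. Qed.

Lemma repB g u v : rep g (u - v) = rep g u - rep g v.
Proof. by rewrite -(scaleN1r v) repD repZ scaleN1r. Qed.

(** The vertices of the complex are of three types; e labels the edges
    leading from a vertex at u to vertices at v. *)
Definition edge_energy (e : X -> G) u v := \sum_x sq (u - rep (e x) v).

(** Up to a scalar, the two parts of the gradient of the energy with respect to
    the vector u: along the edges going out of its vertices and along those
    coming into them. *)
Definition grad_out (e : X -> G) u v := \sum_x (rep (e x) v - u).
Definition grad_in (e : X -> G) u v := \sum_x (rep (e x)^-1%g v - u).

(** The triples weighted by wt behave, for sums of three functions, as if all
    triples had the weight kappa; delta is measured against kappa * N ^ 2, the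
    weight of the triples through one element. *)
Definition almost_uniform (delta kappa : R) (wt : X -> X -> X -> R) :=
  forall f g h : X -> H,
  `|\sum_x \sum_y \sum_z wt x y z * sq (f x + g y + h z) -
    kappa * \sum_x \sum_y \sum_z sq (f x + g y + h z)| <=
  delta * (kappa * N ^+ 2) * (\sum_x sq (f x) + \sum_x sq (g x) + \sum_x sq (h x)).

Lemma almost_uniform_rot delta kappa wt : almost_uniform delta kappa wt ->
  almost_uniform delta kappa (fun y z x => wt x y z).
Proof.
move=> h f g k; have := h k f g.
rewrite (_ : \sum_x sq (k x) + _ + _ = \sum_x sq (f x) + \sum_x sq (g x) + \sum_x sq (k x)); last by ring.
congr (`|_ - _ * _| <= _).
  rewrite exchange_big /=; apply: eq_bigr => y _; rewrite exchange_big /=.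
  by do 2 apply: eq_bigr => ? _; rewrite -addrA addrC.
rewrite exchange_big /=; apply: eq_bigr => y _; rewrite exchange_big /=.
by do 2 apply: eq_bigr => ? _; rewrite -addrA addrC.
Qed.

Lemma edge_energy_inv e u v : \sum_x sq (rep (e x)^-1%g u - v) = edge_energy e u v.
Proof.
apply: eq_bigr => x _.
by rewrite -[LHS](rep_dot (e x)) repB -repM mulgV rep1.
Qed.

Lemma sum_const (c : R) : \sum_(x : X) c = N * c.
Proof. by rewrite sumr_const -[LHS]mulr_natl. Qed.

(** With x, y, z short for a x, b y, c z: the triangles at a vertex of type 0
    join x v1 to z^-1 v2, whose distance is |v1 - y v2| as x y z = 1.  Uniformity makes the link resemble a
    complete bipartite graph, where the mean of |f x - h z|^2 is the sum of
    the means of the squares minus twice the product of the means; it is used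
    once in the link, and once to compare the weighted and the plain energy of
    the opposite edges. *)
Lemma link_inequality (delta kappa : R) wt (a b c : X -> G) v0 v1 v2 :
  0 < kappa -> almost_uniform delta kappa wt ->
  (forall x y z, wt x y z != 0 -> (a x * b y * c z = 1)%g) ->
  (1 - delta) * (edge_energy a v0 v1 + edge_energy c v2 v0)
    - 2 / N * dot (grad_out a v0 v1) (grad_in c v0 v2)
  <= (1 + delta) * edge_energy b v1 v2.
Proof.
move=> k0 wtU wt1.
pose f x := rep (a x) v1 - v0; pose k z := v0 - rep (c z)^-1%g v2.
have fE : \sum_x sq (f x) = edge_energy a v0 v1.
  by apply: eq_bigr => x _; rewrite -[f x]opprB (dotNl ip) (dotNr ip) opprK.
have kE : \sum_x sq (k x) = edge_energy c v2 v0.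
  rewrite -edge_energy_inv; apply: eq_bigr => x _.
  by rewrite -[k x]opprB (dotNl ip) (dotNr ip) opprK.
pose g y := v1 - rep (b y) v2.
have := wtU f (fun=> 0) k; have := wtU (fun=> 0) g (fun=> 0); rewrite /=.
have -> : \sum_(x : X) \sum_y \sum_(z : X) sq (0 + g y + 0) = N ^+ 2 * edge_energy b v1 v2.
  rewrite sum_const expr2 -mulrA; congr (_ * _); rewrite mulr_sumr.
  by apply: eq_bigr => y _; rewrite sum_const add0r addr0.
have -> : \sum_x \sum_(y : X) \sum_z sq (f x + 0 + k z) =
   N ^+ 2 * (edge_energy a v0 v1 + edge_energy c v2 v0) -
   2 * N * dot (grad_out a v0 v1) (grad_in c v0 v2).
  transitivity (\sum_x (N * (N * sq (f x) + 2 * dot (f x) (\sum_z k z) + edge_energy c v2 v0))).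
    apply: eq_bigr => x _; rewrite sum_const; congr (_ * _).
    under eq_bigr => z _ do rewrite addr0 (dot_sqrD ip).
    by rewrite 2!big_split /= sum_const -mulr_sumr -(dot_sumr ip) kE.
  rewrite -mulr_sumr 2!big_split /= sum_const -!mulr_sumr fE -(dot_suml ip).
  have -> : \sum_z k z = - grad_in c v0 v2.
    by rewrite /grad_in -sumrN; apply: eq_bigr => z _; rewrite opprB.
  by rewrite (dotNr ip) -/(grad_out a v0 v1); ring.
rewrite fE kE (dot0l ip) !sum_const !mulr0 !addr0 add0r -/(edge_energy b v1 v2).
have -> : \sum_x \sum_y \sum_z wt x y z * sq (f x + 0 + k z) =
          \sum_x \sum_y \sum_z wt x y z * sq (0 + g y + 0).
  apply: eq_bigr => x _; apply: eq_bigr => y _; apply: eq_bigr => z _.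
  rewrite addr0 add0r addr0.
  have [->|/wt1 e] := eqVneq (wt x y z) 0; first by rewrite !mul0r.
  congr (_ * _); rewrite /f /k addrA subrK /g -(rep_dot (a x) (v1 - _)).
  rewrite repB -repM; congr (dot (_ - rep _ _) (_ - rep _ _)).
    by apply/esym/eqP; rewrite -(inj_eq (mulIg (c z))) e mulVg.
  by apply/esym/eqP; rewrite -(inj_eq (mulIg (c z))) e mulVg.
move=> h2 h1.
have D0 : 0 < kappa * N ^+ 2 by rewrite mulr_gt0 ?exprn_gt0.
rewrite -(ler_pM2l D0).
set T := \sum_x _ in h1 h2.
set g0 := dot _ _ in h1 *; set Ea := edge_energy a _ _ in h1 *.
set Eb := edge_energy b _ _ in h2 *; set Ec := edge_energy c _ _ in h1 *.
have -> : kappa * N ^+ 2 * ((1 - delta) * (Ea + Ec) - 2 / N * g0) =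
  kappa * (N ^+ 2 * (Ea + Ec) - 2 * N * g0) - delta * (kappa * N ^+ 2) * (Ea + Ec).
  by field; rewrite gt_eqF.
have := ler_norm (T - kappa * (N ^+ 2 * Eb)); move/le_trans/(_ h2) => {}h2.
rewrite distrC in h1; have := ler_norm (kappa * (N ^+ 2 * (Ea + Ec) - 2 * N * g0) - T).
move/le_trans/(_ h1) => {}h1.
by move: h1 h2; lra.
Qed.

Variables (delta kappa : R) (wt : X -> X -> X -> R) (a b c : X -> G).
Hypothesis kappa0 : 0 < kappa.
Hypothesis delta6 : delta <= 1 / 6.
Hypothesis wtU : almost_uniform delta kappa wt.
Hypothesis wt1 : forall x y z, wt x y z != 0 -> (a x * b y * c z = 1)%g.

Definition energy v0 v1 v2 :=
  (edge_energy a v0 v1 + edge_energy b v1 v2 + edge_energy c v2 v0) / N.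

Lemma edge_energy_ge0 e u v : 0 <= edge_energy e u v.
Proof. by apply: sumr_ge0 => x _; exact: dot_ge0. Qed.

Lemma energy_ge0 v0 v1 v2 : 0 <= energy v0 v1 v2.
Proof. by rewrite divr_ge0 ?addr_ge0 ?edge_energy_ge0 ?ltW. Qed.

(** Minus one half of the gradient of the energy with respect to the vector
    at one type of vertices. *)
Definition slope (out inn : X -> G) v0 v1 v2 :=
  N^-1 *: (grad_out out v0 v1 + grad_in inn v0 v2).

Lemma slope_dot out inn v0 v1 v2 :
  2 / N * dot (grad_out out v0 v1) (grad_in inn v0 v2) <=
  N / 2 * sq (slope out inn v0 v1 v2).
Proof.
rewrite /slope (dot_sqrZ ip) -(ler_pM2l N0).
set p := grad_out _ _ _; set q := grad_in _ _ _.
have := dot_ge0 ip (p - q); rewrite (dot_sqrB ip) (dot_sqrD ip) => h.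
have -> : N * (2 / N * dot p q) = 2 * dot p q by field; rewrite gt_eqF.
have -> : N * (N / 2 * (N^-1 ^+ 2 * (sq p + 2 * dot p q + sq q))) =
  (sq p + 2 * dot p q + sq q) / 2 by field; rewrite gt_eqF.
lra.
Qed.

(** The sum of [link_inequality] over the three types of vertices, where
    delta <= 1/6 leaves half of the energy. *)
Lemma energy_le_slope v0 v1 v2 :
  energy v0 v1 v2 <= sq (slope a c v0 v1 v2) + sq (slope b a v1 v2 v0) + sq (slope c b v2 v0 v1).
Proof.
have rot x y z : wt x y z != 0 -> (b y * c z * a x = 1)%g.
  move=> /wt1 e; apply: (mulgI (a x)); rewrite !mulgA e mulg1 mul1g //.
have rot2 x y z : wt x y z != 0 -> (c z * a x * b y = 1)%g.
  move=> /rot e; apply: (mulgI (b y)); rewrite !mulgA e mulg1 mul1g //.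
have wtU2 := almost_uniform_rot wtU; have wtU3 := almost_uniform_rot wtU2.
have h0 := link_inequality v0 v1 v2 kappa0 wtU wt1.
have h1 := link_inequality v1 v2 v0 kappa0 wtU2 (fun y z x => @rot x y z).
have h2 := link_inequality v2 v0 v1 kappa0 wtU3 (fun z x y => @rot2 x y z).
rewrite /energy ler_pdivrMr //.
have s0 := slope_dot a c v0 v1 v2; have s1 := slope_dot b a v1 v2 v0.
have s2 := slope_dot c b v2 v0 v1.
have ea := edge_energy_ge0 a v0 v1; have eb := edge_energy_ge0 b v1 v2.
have ec := edge_energy_ge0 c v2 v0.
move: h0 h1 h2 s0 s1 s2 ea eb ec; set Ea := edge_energy a _ _; set Eb := edge_energy b _ _.
set Ec := edge_energy c _ _; have := delta6.
set d0 := 2 / N * _; set d1 := 2 / N * _; set d2 := 2 / N * _.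
set q0 := sq _; set q1 := sq _; set q2 := sq _.
nra.
Qed.

(** The energy is quadratic, with the gradients as linear term. *)
Lemma edge_energy_shift e u v u' v' t :
  edge_energy e (u + t *: u') (v + t *: v') =
  edge_energy e u v - 2 * t * (dot (grad_out e u v) u' + dot (grad_in e v u) v')
   + t ^+ 2 * edge_energy e u' v'.
Proof.
have -> : dot (grad_out e u v) u' + dot (grad_in e v u) v' =
   - \sum_x dot (u - rep (e x) v) (u' - rep (e x) v').
  rewrite !(dot_suml ip) -big_split -sumrN; apply: eq_bigr => x _ /=.
  rewrite -(rep_dot (e x) _ v') repB -repM mulgV rep1 (dotDr ip) (dotNr ip).
  by rewrite -(opprB (rep (e x) v) u) !(dotNl ip); ring.
rewrite /edge_energy mulr_sumr mulrN opprK mulr_sumr -!big_split /=.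
apply: eq_bigr => x _.
have -> : u + t *: u' - rep (e x) (v + t *: v') =
   (u - rep (e x) v) + t *: (u' - rep (e x) v').
  by rewrite repD repZ scalerBr opprD addrACA.
by rewrite (dot_sqrD ip) (dot_sqrZ ip) (dotZr ip); ring.
Qed.

Lemma edge_energy_le e u v : edge_energy e u v <= 2 * N * (sq u + sq v).
Proof.
rewrite mulrAC mulrC -sum_const; apply: ler_sum => x _.
have := dot_ge0 ip (u + rep (e x) v).
by rewrite (dot_sqrD ip) (dot_sqrB ip) rep_dot; lra.
Qed.

(** Add one quarter of the slopes: the linear gain is
    |slope|^2 / 2, the quadratic loss at most |slope|^2 / 4, and the
    remaining decrease is at least one quarter of the energy. *)
Lemma energy_descent v0 v1 v2 : exists w0 w1 w2,
  energy (v0 + w0) (v1 + w1) (v2 + w2) <= 3 / 4 * energy v0 v1 v2 /\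
  sq w0 + sq w1 + sq w2 <= 1 / 4 * energy v0 v1 v2.
Proof.
pose s0 := slope a c v0 v1 v2; pose s1 := slope b a v1 v2 v0.
pose s2 := slope c b v2 v0 v1.
exists (4^-1 *: s0), (4^-1 *: s1), (4^-1 *: s2).
have ds out inn x y z : dot (grad_out out x y) (slope out inn x y z) +
   dot (grad_in inn x z) (slope out inn x y z) = N * sq (slope out inn x y z).
  rewrite -(dotDl ip) /slope; set g := _ + _.
  by rewrite (dot_sqrZ ip) (dotZr ip); field; rewrite gt_eqF.
have e0 := ds a c v0 v1 v2; have e1 := ds b a v1 v2 v0; have e2 := ds c b v2 v0 v1.
have l0 := edge_energy_le a s0 s1; have l1 := edge_energy_le b s1 s2.
have l2 := edge_energy_le c s2 s0.
have main : energy (v0 + 4^-1 *: s0) (v1 + 4^-1 *: s1) (v2 + 4^-1 *: s2) <=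
   energy v0 v1 v2 - 1 / 4 * (sq s0 + sq s1 + sq s2).
  rewrite /energy -(ler_pM2l N0) mulrBr !(mulrCA N) mulfV ?gt_eqF // !mulr1.
  rewrite !edge_energy_shift; move: e0 e1 e2 l0 l1 l2; rewrite -/s0 -/s1 -/s2; lra.
have le_s := energy_le_slope v0 v1 v2; rewrite -/s0 -/s1 -/s2 in le_s.
have := energy_ge0 (v0 + 4^-1 *: s0) (v1 + 4^-1 *: s1) (v2 + 4^-1 *: s2).
have q16 s : sq (4^-1 *: s) = 1 / 16 * sq s by rewrite (dot_sqrZ ip); field.
rewrite (q16 s0) (q16 s1) (q16 s2); move: le_s main.
set E' := energy (v0 + _) _ _; set E := energy v0 v1 v2.
by split; lra.
Qed.
End Energy.

(** * The hypergraph of triples *)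

(** The vertices are three disjoint copies of X and the hyperedges are the
    triples (x, y, z).  [triple_mx s] is the matrix of the form
    |f x + g y + h z|^2 when s encodes (x, y, z), and is 0 when s does not
    encode a triple. *)
Section Triples.
Variables (R : realType) (X S : finType) (enc : X * X * X -> S).
Hypothesis enc_inj : injective enc.
Local Notation V := (X + X + X)%type.
Local Notation triple := (X * X * X)%type.
Implicit Types (t : triple) (v w : V).

Definition vertex_of t v : R :=
  match v with
  | inl (inl x) => (x == t.1.1)%:R
  | inl (inr y) => (y == t.1.2)%:R
  | inr z => (z == t.2)%:R
  end.

Definition triple_mx (s : S) v w : R :=
  \sum_(t | enc t == s) vertex_of t v * vertex_of t w.

Lemma sum_delta (f : X -> R) x0 : \sum_x (x == x0)%:R * f x = f x0.
Proof.
rewrite (bigD1 x0) //= eqxx mul1r big1 ?addr0 // => x /negPf->.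
by rewrite mul0r.
Qed.

Lemma vertex_of_ge0 t v : 0 <= vertex_of t v.
Proof. by case: v => [[]|]. Qed.

Lemma vertex_of_sum t : \sum_w vertex_of t w = 3.
Proof.
rewrite !big_sumType /=.
have e (x0 : X) : \sum_x (x == x0)%:R = 1 :> R.
  by have := sum_delta (fun=> 1) x0; under eq_bigr => x _ do rewrite mulr1.
by rewrite !e; ring.
Qed.

Lemma triple_mx_ge0 s v w : 0 <= triple_mx s v w.
Proof. by apply: sumr_ge0 => t _; rewrite mulr_ge0 ?vertex_of_ge0. Qed.

Lemma triple_mx_sym s v w : triple_mx s v w = triple_mx s w v.
Proof. by apply: eq_bigr => t _; rewrite mulrC. Qed.

Lemma triple_mx_row s v : \sum_w triple_mx s v w <= 3.
Proof.
rewrite exchange_big /=.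
under eq_bigr => t _ do rewrite -mulr_sumr vertex_of_sum.
case: (pickP (fun t => enc t == s)) => [t /eqP ts|e0]; last by rewrite big_pred0.
rewrite (big_pred1 t) => [|t']; last by rewrite /= -ts (inj_eq enc_inj).
by rewrite ler_piMl //; case: v => [[]|] x /=; case: eqP.
Qed.

Lemma triple_mx_total v :
  \sum_s \sum_w triple_mx s v w = 3 * #|X|%:R ^+ 2.
Proof.
under eq_bigr => s _ do rewrite exchange_big /=.
rewrite (exchange_big_dep xpredT) //=.
have e t : \sum_(s | enc t == s) \sum_w vertex_of t v * vertex_of t w = 3 * vertex_of t v.
  rewrite (big_pred1 (enc t)) => [|s]; last by rewrite /= eq_sym.
  by rewrite -mulr_sumr vertex_of_sum mulrC.
rewrite (eq_bigr _ (fun t _ => e t)) -mulr_sumr; congr (_ * _).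
have d (x0 : X) : \sum_x (x0 == x)%:R = 1 :> R.
  by rewrite (bigD1 x0) //= eqxx big1 ?addr0 // => x; rewrite eq_sym => /negPf->.
have c1 (x : R) : \sum_(y : X) x = #|X|%:R * x by rewrite sumr_const mulr_natl.
rewrite -(pair_bigA _ (fun p z => vertex_of (p, z) v)) /=.
rewrite -(pair_bigA _ (fun x y => \sum_z vertex_of ((x, y), z) v)) /=.
case: v {e} => [[]|] x0 /=.
- under eq_bigr => x _ do rewrite c1.
  by under eq_bigr => x _ do rewrite c1; rewrite -!mulr_sumr d; ring.
- rewrite c1; under eq_bigr => x _ do rewrite c1.
  by rewrite -!mulr_sumr d; ring.
- by rewrite !c1 d; ring.
Qed.

Variables (H : lmodType R) (dot : H -> H -> R).
Hypothesis ip : real_inner dot.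

Definition glue (f g h : X -> H) : {ffun V -> H} :=
  [ffun v => match v with
    | inl (inl x) => f x | inl (inr y) => g y | inr z => h z end].

Lemma glue_norm f g h : dotF dot (glue f g h) (glue f g h) =
  \sum_x dot (f x) (f x) + \sum_x dot (g x) (g x) + \sum_x dot (h x) (h x).
Proof.
rewrite /dotF !big_sumType /=; congr (_ + _ + _);
  by apply: eq_bigr => x _; rewrite ffunE.
Qed.

Lemma glue_triple f g h s :
  dotF dot (glue f g h) (mxact (triple_mx s) (glue f g h)) =
  \sum_(t | enc t == s) dot (f t.1.1 + g t.1.2 + h t.2) (f t.1.1 + g t.1.2 + h t.2).
Proof.
set F := glue f g h.
have Ft t : \sum_w vertex_of t w *: F w = f t.1.1 + g t.1.2 + h t.2.
  have e (k : X -> H) x0 : \sum_x (x == x0)%:R *: k x = k x0.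
    rewrite (bigD1 x0) //= eqxx scale1r big1 ?addr0 // => x /negPf->.
    by rewrite scale0r.
  rewrite !big_sumType /=; congr (_ + _ + _); rewrite -[RHS]e;
    by apply: eq_bigr => x _; rewrite ffunE.
transitivity (\sum_(t | enc t == s) \sum_v vertex_of t v * dot (F v) (\sum_w vertex_of t w *: F w)).
  rewrite /dotF exchange_big /=; apply: eq_bigr => v _.
  rewrite [mxact _ _ v]ffunE (dot_sumr ip).
  transitivity (\sum_w \sum_(t | enc t == s) vertex_of t v * (vertex_of t w * dot (F v) (F w))).
    apply: eq_bigr => w _; rewrite (dotZr ip) /triple_mx mulr_suml.
    by apply: eq_bigr => t _; rewrite mulrA.
  rewrite exchange_big /=; apply: eq_bigr => t _.
  rewrite (dot_sumr ip) mulr_sumr; apply: eq_bigr => w _.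
  by rewrite (dotZr ip).
apply: eq_bigr => t _; rewrite -Ft [RHS](dot_suml ip).
by apply: eq_bigr => v _; rewrite (dotZl ip).
Qed.

Variable m : nat.
Implicit Types r : {ffun 'I_m -> S}.

Definition triple_count r (x y z : X) : R :=
  #|[set i | enc (x, y, z) == r i]|%:R.

(** The deviation bound of [good_sample_deviation] for the matrices
    [triple_mx], whose forms are computed in [glue_triple]. *)
Lemma good_sample_uniform (j : nat) (eta delta : R) r :
  0 < eta -> (0 < m)%N -> (0 < #|S|)%N ->
  2 * eta = delta * (m%:R / #|S|%:R * #|X|%:R ^+ 2) ->
  good_sample triple_mx j eta r ->
  almost_uniform dot delta (m%:R / #|S|%:R) (triple_count r).
Proof.
move=> eta0 m0 S0 etaE gr f g h.
have := good_sample_deviation eta0 m0 S0 triple_mx_sym ip (glue f g h) gr.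
rewrite glue_norm etaE; congr (`|_ - _ * _| <= _).
  under eq_bigr => i _ do rewrite glue_triple.
  rewrite (exchange_big_dep xpredT) //= !pair_bigA /=; apply: eq_bigr => -[[x y] z] _ /=.
  by rewrite sumr_const -mulr_natl /triple_count cardsE.
under eq_bigr => s _ do rewrite glue_triple.
rewrite (exchange_big_dep xpredT) //= !pair_bigA /=; apply: eq_bigr => -[[x y] z] _ /=.
by rewrite (big_pred1 (enc (x, y, z))) // => s; rewrite /= eq_sym.
Qed.
End Triples.

(** * Minimizing the energy in a Hilbert space *)

Local Open Scope classical_set_scope.

(** Restriction of scalars to the reals, on a type of its own so that the two
    module structures do not interfere. *)
Definition realified (R : realType) (H : lmodType R[i]) : Type := H.

Section Realified.
Local Open Scope complex_scope.
Variables (R : realType) (H : lmodType R[i]).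
HB.instance Definition _ := GRing.Zmodule.copy (realified H) H.
Let rscale (a : R) (u : realified H) : realified H := a%:C *: (u : H).
Fact rscaleA a b u : rscale a (rscale b u) = rscale (a * b) u.
Proof. by rewrite /rscale scalerA -rmorphM. Qed.
Fact rscale1 : left_id 1 rscale.
Proof. by move=> u; rewrite /rscale scale1r. Qed.
Fact rscaleDr : right_distributive rscale +%R.
Proof. by move=> a u v; rewrite /rscale scalerDr. Qed.
Fact rscaleDl u : {morph rscale^~ u : a b / a + b}.
Proof. by move=> a b; rewrite /rscale rmorphD scalerDl. Qed.
HB.instance Definition _ :=
  GRing.Zmodule_isLmodule.Build R (realified H) rscaleA rscale1 rscaleDr rscaleDl.
Lemma rscaleE (a : R) (u : realified H) : a *: u = a%:C *: (u : H) :> H.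
Proof. by []. Qed.
End Realified.

Section RealInnerProduct.
Local Open Scope complex_scope.
Variables (R : realType) (H : completeNormedModType R[i]).
Variable ip : {dot H for @Num.conj R[i]}.
Hypothesis ipP : inner_product ip.

Definition re_dot (u v : realified H) : R := complex.Re (ip u v).

Lemma re_dot_inner : real_inner re_dot.
Proof.
split=> [u v|u v w|a u w|u]; rewrite /re_dot.
- by rewrite hermC /= expr0 mul1r; case: (ip v u).
- by rewrite linearDl raddfD.
- by rewrite rscaleE linearZl_LR /=; case: (ip u w) => x y /=; rewrite mul0r subr0.
- rewrite -ipP; have : 0 <= `|u : H| ^+ 2 by rewrite exprn_ge0.
  by case: (_ ^+ 2) => x y; rewrite lecE /= => /andP[].
Qed.

Definition rnorm (u : H) : R := complex.Re `|u|.

Lemma norm_rnorm u : `|u| = (rnorm u)%:C.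
Proof.
have : 0 <= `|u : H| by [].
by rewrite /rnorm; case: (`|_|) => x y; rewrite lecE /= => /andP[/eqP-> _].
Qed.

Lemma rnorm_ge0 u : 0 <= rnorm u.
Proof. by have := normr_ge0 u; rewrite norm_rnorm ler0c. Qed.

Lemma rnormD u v : rnorm (u + v) <= rnorm u + rnorm v.
Proof. by have := ler_normD u v; rewrite !norm_rnorm -rmorphD lecR. Qed.

Lemma rnormB u v : rnorm (u - v) = rnorm (v - u).
Proof. by rewrite /rnorm distrC. Qed.

Lemma rnorm_sqr u : rnorm u ^+ 2 = re_dot u u.
Proof.
by rewrite /re_dot -ipP norm_rnorm -rmorphXn.
Qed.

Lemma rnorm0_eq0 u : rnorm u = 0 -> u = 0.
Proof. by move=> u0; apply/normr0_eq0; rewrite norm_rnorm u0. Qed.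

Lemma pos_complexE (e : R[i]) : 0 < e -> exists2 r : R, 0 < r & e = r%:C.
Proof.
case: e => x y; rewrite ltcE /= => /andP[/eqP-> x0]; by exists x.
Qed.

Lemma geometric_small (K q e : R) : 0 <= q < 1 -> 0 < e ->
  exists n, K * q ^+ n < e.
Proof.
move=> /andP[q0 q1] e0.
have /(cvg_geometric K) : `|q| < 1 by rewrite ger0_norm.
move=> /cvgrPdist_lt /(_ e e0) [n _ /(_ n (leqnn n))] /=.
rewrite sub0r normrN => h; exists n.
by apply: le_lt_trans h; exact: ler_norm.
Qed.

(** Telescoping increments of geometric size; completeness provides the
    limit. *)
Lemma geometric_limit (u : nat -> H) (c q : R) : 0 <= q < 1 ->
  (forall n, rnorm (u n.+1 - u n) <= c * q ^+ n) ->
  exists l, forall n, rnorm (l - u n) <= c * q ^+ n / (1 - q).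
Proof.
move=> /andP[q0 q1] hu.
have q1' : 0 < 1 - q by rewrite subr_gt0.
have c0 : 0 <= c by have := le_trans (rnorm_ge0 _) (hu 0%N); rewrite expr0 mulr1.
have hk n k : rnorm (u (n + k)%N - u n) <= c * q ^+ n / (1 - q).
  suff : rnorm (u (n + k)%N - u n) <= c * q ^+ n * (1 - q ^+ k) / (1 - q).
    move/le_trans; apply; rewrite ler_wpM2r ?invr_ge0 ?(ltW q1') //.
    by rewrite ler_piMr ?mulr_ge0 ?exprn_ge0 // gerBl exprn_ge0.
  elim: k => [|k IHk].
    by rewrite addn0 subrr expr0 subrr mulr0 mul0r /rnorm normr0.
  rewrite addnS -(subrK (u (n + k)%N) (u _.+1)) -addrA.
  apply: le_trans (rnormD _ _) _; apply: le_trans (lerD (hu _) IHk) _.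
  rewrite le_eqVlt; apply/orP; left; apply/eqP.
  by rewrite exprD exprS; field; rewrite gt_eqF.
have qq : 0 <= q < 1 by rewrite q0.
have hcvg : cvg (u @ \oo).
  apply: cauchy_cvg; apply: cauchy_exP => e /pos_complexE[r r0 ->].
  have [n] := geometric_small (c / (1 - q)) qq r0.
  rewrite mulrAC => hn; exists (u n); exists n => // k /= nk.
  rewrite -ball_normE /ball_ /= norm_rnorm ltcR rnormB -(subnKC nk).
  exact: le_lt_trans (hk _ _) hn.
exists (lim (u @ \oo)) => n; apply/ler_addgt0Pr => e e0.
have e0' : 0 < e%:C :> R[i] by rewrite ltcR.
move/cvgrPdist_lt : hcvg => /(_ _ e0') [k _ /(_ (n + k)%N)] /=.
rewrite leq_addl norm_rnorm ltcR => /(_ isT) /ltW hd.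
rewrite -(subrK (u (n + k)%N) (lim _)) -addrA.
apply: le_trans (rnormD _ _) _; rewrite [leRHS]addrC; exact: lerD hd (hk _ _).
Qed.
End RealInnerProduct.

Section InvariantTriple.
Local Open Scope complex_scope.
Variables (R : realType) (G : groupType) (H : completeNormedModType R[i]).
Variable ip : {dot H for @Num.conj R[i]}.
Hypothesis ipP : inner_product ip.
Variable pi : G -> {linear H -> H}.
Hypothesis piP : unitary_rep ip pi.
Variable X : finType.
Hypothesis X0 : (0 < #|X|)%N.
Variables (kappa : R) (wt : X -> X -> X -> R) (a b c : X -> G).
Hypothesis kappa0 : 0 < kappa.
Local Notation dotR := (re_dot ip).
Hypothesis wtU : almost_uniform (H := realified H) dotR (1 / 6) kappa wt.
Hypothesis wt1 : forall x y z, wt x y z != 0 -> (a x * b y * c z = 1)%g.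

Let ipR : real_inner dotR := re_dot_inner ipP.
Let rep (g : G) (u : realified H) : realified H := pi g u.
Let rep1 u : rep 1%g u = u. Proof. by case: piP => e _ _; exact: e. Qed.
Let repM g h u : rep (g * h)%g u = rep g (rep h u). Proof. by case: piP => _ e _; exact: e. Qed.
Let repD g u v : rep g (u + v) = rep g u + rep g v.
Proof. exact: (raddfD (pi g)). Qed.
Let repZ g (r : R) u : rep g (r *: u) = r *: rep g u.
Proof. exact: (linearZ_LR (pi g) r%:C u). Qed.
Let rep_dot g u v : dotR (rep g u) (rep g v) = dotR u v.
Proof. by case: piP => _ _ e; rewrite /re_dot e. Qed.

Lemma rnorm_pi g u : rnorm (pi g u) = rnorm u.
Proof.
apply/eqP; rewrite -(@eqrXn2 _ 2) ?rnorm_ge0 // !(rnorm_sqr ipP).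
by rewrite -[X in _ == X](rep_dot g).
Qed.

Local Notation E := (energy dotR rep a b c).

(** The descent of [energy_descent] started at (v, v, v): the energy is
    multiplied by at most 3/4 and the step is at most half of its square root,
    so the steps decrease geometrically and the limit has energy zero. *)
Lemma invariant_triple v : exists v0 v1 v2,
  [/\ forall x, v0 = pi (a x) v1, forall x, v1 = pi (b x) v2,
    forall x, v2 = pi (c x) v0 & rnorm (v0 - v) <= 4 * Num.sqrt (E v v v)].
Proof.
pose H3 := (H * H * H)%type; pose E3 (t : H3) := E t.1.1 t.1.2 t.2.
have step (t : H3) : exists w : H3,
    E (t.1.1 + w.1.1) (t.1.2 + w.1.2) (t.2 + w.2) <= 3 / 4 * E3 t /\
    [/\ rnorm w.1.1 ^+ 2 <= 1 / 4 * E3 t, rnorm w.1.2 ^+ 2 <= 1 / 4 * E3 t &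
     rnorm w.2 ^+ 2 <= 1 / 4 * E3 t].
  have [//|w0 [w1 [w2 [h1 h2]]]] := energy_descent ipR rep1 repM repD repZ rep_dot X0 kappa0 _ wtU wt1 t.1.1 t.1.2 t.2.
  exists (w0, w1, w2); rewrite !(rnorm_sqr ipP) /=; split=> //.
  have d0 := dot_ge0 ipR w0; have d1 := dot_ge0 ipR w1; have d2 := dot_ge0 ipR w2.
  by rewrite /E3; split; lra.
have [f fP] := choice step.
pose u := fix u n : H3 := if n is n'.+1 then
  ((u n').1.1 + (f (u n')).1.1, (u n').1.2 + (f (u n')).1.2, (u n').2 + (f (u n')).2)
  else (v, v, v).
pose s := Num.sqrt (E v v v); have sE : s = Num.sqrt (E v v v) by [].
(* the ratio only has to satisfy q ^ 2 >= 3 / 4 *)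
pose q : R := 7 / 8; have qE : q = 7 / 8 by [].
have E0 t : 0 <= E3 t by exact: (energy_ge0 rep ipR).
have s2 : s ^+ 2 = E v v v by rewrite sqr_sqrtr // (E0 (v, v, v)).
have s0 : 0 <= s by exact: sqrtr_ge0.
clearbody s q.
have q0 : 0 <= q by rewrite qE; lra.
have hq : 0 <= q < 1 by rewrite qE; apply/andP; split; lra.
have En n : E3 (u n) <= (s * q ^+ n) ^+ 2.
  elim: n => [|n IHn]; first by rewrite expr0 mulr1 s2.
  apply: le_trans (proj1 (fP (u n))) _.
  have -> : (s * q ^+ n.+1) ^+ 2 = q ^+ 2 * (s * q ^+ n) ^+ 2 by rewrite (exprS q n); ring.
  have : 3 / 4 <= q ^+ 2 by rewrite qE; lra.
  have := E0 (u n); have := sqr_ge0 (s * q ^+ n).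
  by move: IHn; set A := E3 _; set B := _ ^+ 2; set C := q ^+ 2; nra.
have bound (w : H) n : rnorm w ^+ 2 <= 1 / 4 * E3 (u n) -> rnorm w <= s / 2 * q ^+ n.
  move=> hw; rewrite -(@ler_pXn2r _ 2) ?nnegrE ?mulr_ge0 ?exprn_ge0 ?invr_ge0 ?rnorm_ge0 //.
  apply: le_trans hw _; apply: le_trans (ler_wpM2l _ (En n)) _; first by lra.
  by rewrite le_eqVlt; apply/orP; left; apply/eqP; field.
have [l0 h0] : exists l, forall n, rnorm (l - (u n).1.1) <= s / 2 * q ^+ n / (1 - q).
  apply: (geometric_limit hq) => n /=; rewrite addrAC subrr add0r.
  by apply: bound; case: (fP (u n)) => _ [].
have [l1 h1] : exists l, forall n, rnorm (l - (u n).1.2) <= s / 2 * q ^+ n / (1 - q).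
  apply: (geometric_limit hq) => n /=; rewrite addrAC subrr add0r.
  by apply: bound; case: (fP (u n)) => _ [].
have [l2 h2] : exists l, forall n, rnorm (l - (u n).2) <= s / 2 * q ^+ n / (1 - q).
  apply: (geometric_limit hq) => n /=; rewrite addrAC subrr add0r.
  by apply: bound; case: (fP (u n)) => _ [].
have N0 : 0 <= #|X|%:R :> R by [].
have N1 : 0 < #|X|%:R :> R by rewrite ltr0n.
have edge (e : X -> G) (x y : H) n : edge_energy dotR rep e x y <= #|X|%:R * E3 (u n) ->
    forall k, rnorm (x - pi (e k) y) <= #|X|%:R * s * q ^+ n.
  move=> he k.
  rewrite -(@ler_pXn2r _ 2) ?nnegrE ?mulr_ge0 ?exprn_ge0 ?rnorm_ge0 //.
  apply: (@le_trans _ _ (#|X|%:R * E3 (u n))).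
    apply: le_trans he; rewrite (rnorm_sqr ipP) /edge_energy (bigD1 k) //= lerDl.
    by apply: sumr_ge0 => j _; exact: dot_ge0.
  rewrite -mulrA exprMn; apply: ler_pM => //.
  by rewrite ler_eXnr // ler1n.
have lim0 (e : X -> G) (x y : nat -> H) (lx ly : H) :
    (forall n, rnorm (lx - x n) <= s / 2 * q ^+ n / (1 - q)) ->
    (forall n, rnorm (ly - y n) <= s / 2 * q ^+ n / (1 - q)) ->
    (forall n, edge_energy dotR rep e (x n) (y n) <= #|X|%:R * E3 (u n)) ->
    forall k, lx = pi (e k) ly.
  move=> hx hy hE k; apply/eqP; rewrite -subr_eq0; apply/eqP/rnorm0_eq0.
  apply/eqP; rewrite eq_le rnorm_ge0 andbT leNgt; apply/negP => r0.
  have [n] := geometric_small (s / (1 - q) + #|X|%:R * s) hq r0; apply/negP; rewrite -leNgt.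
  have -> : lx - pi (e k) ly = (lx - x n) + ((x n - pi (e k) (y n)) + pi (e k) (y n - ly)).
    by rewrite raddfB /=; rewrite addrA !subrKA.
  apply: le_trans (rnormD _ _) _; apply: le_trans (lerD (hx n) (rnormD _ _)) _.
  apply: le_trans (lerD (lexx _) (lerD (edge _ _ _ _ (hE n) k) (lexx _))) _.
  rewrite rnorm_pi rnormB.
  apply: le_trans (lerD (lexx _) (lerD (lexx _) (hy n))) _.
  by rewrite le_eqVlt; apply/orP; left; apply/eqP; field; rewrite qE; lra.
have NE n : #|X|%:R * E3 (u n) = edge_energy dotR rep a (u n).1.1 (u n).1.2
   + edge_energy dotR rep b (u n).1.2 (u n).2 + edge_energy dotR rep c (u n).2 (u n).1.1.
  by rewrite /E3 /energy mulrC divfK ?gt_eqF.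
have ee e x y : 0 <= edge_energy dotR rep e x y by exact: (edge_energy_ge0 rep ipR).
exists l0, l1, l2; split.
- apply: (lim0 _ (fun n => (u n).1.1) (fun n => (u n).1.2)) => // n.
  by rewrite NE -addrA lerDl addr_ge0.
- apply: (lim0 _ (fun n => (u n).1.2) (fun n => (u n).2)) => // n.
  by rewrite NE addrAC lerDr addr_ge0.
- apply: (lim0 _ (fun n => (u n).2) (fun n => (u n).1.1)) => // n.
  by rewrite NE lerDr addr_ge0.
- by have := h0 0%N; rewrite expr0 mulr1 /=; congr (_ <= _); rewrite -sE qE; field.
Qed.
End InvariantTriple.

(** * Reduced words and their concatenation *)

Section Words.
Variable n : nat.
Local Notation L := ('I_n * bool)%type.
Implicit Types (x y s : L) (u v w : seq L).

Definition no_cancel x y := y != letter_inv x :> L.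

Lemma no_cancelC x y : no_cancel x y = no_cancel y x.
Proof.
rewrite /no_cancel; apply/negP/negP => h /eqP e; apply: h; apply/eqP.
  by rewrite e letter_invK.
by rewrite e letter_invK.
Qed.

Lemma card_reduced j x :
  #|[set w : j.-tuple L | path no_cancel x w]%SET| = ((2 * n - 1) ^ j)%N.
Proof.
elim: j x => [|j IHj] x.
  rewrite expn0 (_ : [set w : 0.-tuple L | _]%SET = [set [tuple]]%SET) ?cards1 //.
  by apply/setP => w; rewrite (tuple0 w) !finset.inE /= eqxx.
rewrite -sum1dep_card big_mkcond /= big_tupleS /= (bigID (no_cancel x)) /=.
rewrite [X in (_ + X)%N]big1 ?addn0; last first.
  by move=> y /negPf xy; rewrite big1 // => w _; rewrite xy.
rewrite (eq_bigr (fun=> (2 * n - 1) ^ j)%N) => [|y xy].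
  rewrite sum_nat_const expnS; congr (_ * _)%N.
  rewrite (eq_card (B := predC1 (letter_inv x : L))) //.
  by rewrite cardC1 card_prod card_ord card_bool mulnC subn1.
by rewrite -(IHj y) -sum1dep_card [RHS]big_mkcond; apply: eq_bigr => w _; rewrite xy.
Qed.

Lemma card_cyc_red k : (#|cyc_red_words n k.+1| <= 2 * n * (2 * n - 1) ^ k)%N.
Proof.
rewrite -sum1dep_card big_mkcond /= big_tupleS /=.
have eL : (2 * n = #|{: L}|)%N by rewrite card_prod card_ord card_bool mulnC.
rewrite {1}eL.
rewrite -sum_nat_const; apply: leq_sum => x _.
rewrite -(card_reduced k x) -sum1dep_card [X in (_ <= X)%N]big_mkcond /=.
apply: leq_sum => w _; rewrite /cyclically_reduced /= rcons_path.
case: ifP => // /andP[h _]; case: ifP => //.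
by rewrite /no_cancel h.
Qed.

Variables (a b : 'I_n).
Hypothesis ab : a != b.
Local Notation la := ((a, false) : L).
Local Notation ia := ((a, true) : L).

(** Starting with a and not ending with its inverse makes every product of
    blocks, read cyclically, free of cancellation. *)
Definition block w :=
  if w is x :: w' then [&& x == la, path no_cancel la w' & last la w' != ia]
  else false.

Lemma block_cat u v : block u -> block v -> block (u ++ v).
Proof.
case: u => // x u /and3P[/eqP-> pu lu]; case: v => // y v /and3P[/eqP-> pv lv] /=.
rewrite eqxx cat_path pu last_cat /= pv lv !andbT /=.
by rewrite no_cancelC.
Qed.

Lemma block_nseq j w : block w -> block (nseq j la ++ w).
Proof.
move=> bw; elim: j => //= j IHj.
by apply: (@block_cat [:: la]) => //=; rewrite !xpair_eqE !eqxx.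
Qed.

Lemma block_cyc w : block w -> cyclically_reduced w.
Proof.
case: w => // x w /and3P[/eqP-> pw lw] /=; rewrite rcons_path pw.
by rewrite -/(no_cancel _ _) no_cancelC.
Qed.

Definition block_tuple l := {t : l.-tuple L | block t}.

(** A letter that can follow s and end a block. *)
Definition closing s : L := if s == (b, true) then (b, true) else (b, false).

Lemma closing_ok s : no_cancel s (closing s) /\ closing s != ia.
Proof.
rewrite /closing; case: s => c e; rewrite -pair_eqE /pair_eq /= eqb_id.
have nc (x y : 'I_n) (f g : bool) : no_cancel (x, f) (y, g) = ~~ ((y == x) && (g == ~~ f)).
  by [].
have neq (f g : bool) : ((b, f) != (a, g)) by rewrite xpair_eqE eq_sym (negPf ab).
by case: e; case: (c =P b) => [->|/eqP cb] /=; rewrite !nc ?neq ?andbF // eq_sym (negPf cb).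
Qed.

(** After the initial a, any reduced word can be completed by [closing]. *)
Lemma card_block l : ((2 * n - 1) ^ l <= #|{: block_tuple l.+2}|)%N.
Proof.
rewrite -(card_reduced l la) card_sig.
pose f (w : l.-tuple L) : l.+2.-tuple L := [tuple of la :: rcons w (closing (last la w))].
rewrite -(@card_in_imset _ _ f); last first.
  move=> w w' _ _ /(congr1 val) /= [] /eqP; rewrite eqseq_rcons => /andP[/eqP e _].
  exact: val_inj.
apply: subset_leq_card; apply/fintype.subsetP => t /imsetP[w].
rewrite finset.inE => pw ->; rewrite unfold_in /= eqxx rcons_path pw last_rcons /=.
by have [-> ->] := closing_ok (last la w).
Qed.

Section Encoding.
Variables l j : nat.
Local Notation X := (block_tuple l).
Local Notation k := (l + (l + (j + l)))%N.

Definition encode_word (t : X * X * X) : k.-tuple L :=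
  [tuple of val t.1.1 ++ [tuple of val t.1.2 ++ [tuple of nseq_tuple j la ++ val t.2]]].

Lemma encode_cyc t : encode_word t \in cyc_red_words n k.
Proof.
rewrite finset.inE /=; apply: block_cyc.
by apply: block_cat (valP t.1.1) _; apply: block_cat (valP t.1.2) _; apply: block_nseq; apply: (valP t.2).
Qed.

Lemma encode_inj : injective encode_word.
Proof.
move=> [[x y] z] [[x' y'] z'] /(congr1 val) /= /eqP.
rewrite eqseq_cat ?size_tuple // => /andP[/eqP ex]; rewrite eqseq_cat ?size_tuple //.
move=> /andP[/eqP ey]; rewrite eqseq_cat ?size_nseq // => /andP[_ /eqP ez].
by congr (_, _, _); apply: val_inj; apply: val_inj.
Qed.
End Encoding.
End Words.

(** * Property (T) from a good sample of relators *)

Section Presented.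
Variables (n : nat) (rels : set (word 'I_n)).
Local Notation L := ('I_n * bool)%type.
Local Notation G := (presented rels).
Local Notation cls := (word_class rels).
Implicit Types (w : seq L) (s : L).

Definition letter_classes : seq G := [seq cls [:: s] | s <- enum {: L}].

Lemma cls_cat w w' : cls (w ++ w') = (cls w * cls w')%g.
Proof. by rewrite -word_class_mul. Qed.

Lemma cls_nil : cls [::] = 1%g. Proof. by []. Qed.

Lemma letter_classes_generate : generates letter_classes.
Proof.
move=> K K1 KM KV KS g; rewrite -(word_class_repr g).
elim: (repr g) => [|x w IHw]; first exact: K1.
rewrite -cat1s cls_cat; apply: KM => //; apply: KS.
by apply/mapP; exists x; rewrite ?mem_enum.
Qed.

Variables (R : realType) (H : completeNormedModType R[i]).
Variable ip : {dot H for @Num.conj R[i]}.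
Hypothesis ipP : inner_product ip.
Variable pi : G -> {linear H -> H}.
Hypothesis piP : unitary_rep ip pi.
Local Notation P w := (pi (cls w)).

Lemma word_actD w w' u : P (w ++ w') u = P w (P w' u).
Proof. by case: piP => _ piM _; rewrite cls_cat piM. Qed.

Lemma word_act0 u : P [::] u = u.
Proof. by case: piP => pi1 _ _; rewrite cls_nil pi1. Qed.

Lemma word_act_inj w : injective (P w).
Proof.
move=> u u' e; have : P (word_inv w ++ w) u = P (word_inv w ++ w) u'.
  by rewrite !word_actD e.
suff -> : cls (word_inv w ++ w) = cls [::] by rewrite !word_act0.
by rewrite -[X in _ ++ X](word_invK w); apply/word_class_eq/pres_invr.
Qed.

Lemma letter_act_inv s u : P [:: s] (P [:: letter_inv s] u) = u.
Proof.
rewrite -word_actD -[RHS]word_act0; congr (pi _ u).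
exact/word_class_eq/pres_cancel.
Qed.

(** Unitary operators do not accumulate more than one error per letter. *)
Lemma word_act_almost (v : H) (e : R) w :
  (forall s, rnorm (P [:: s] v - v) <= e) ->
  rnorm (P w v - v) <= (size w)%:R * e.
Proof.
move=> ve; elim: w => [|s w IHw].
  by rewrite word_act0 subrr mul0r /rnorm normr0.
rewrite -cat1s word_actD /= -(subrK (P [:: s] v) (P [:: s] _)) -addrA -raddfB.
apply: le_trans (rnormD _ _) _; rewrite (rnorm_pi ipP piP).
by rewrite -natr1 mulrDl mul1r; apply: lerD.
Qed.

Variables (a b : 'I_n).
Hypothesis ab : a != b.
Local Notation la := ((a, false) : L).
Local Notation ia := ((a, true) : L).
Local Notation lb := ((b, false) : L).

(** All blocks carry v1 to v0.  Blocks with the same beginning and different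
    last letters show that all letters except the inverse of a carry v1 to the
    same vector q; hence words one letter shorter carry q to v0, without
    condition on their end.  Repeating the argument, now with every letter,
    all letters carry q to the same q', so their inverses carry q' back to q,
    and q + q' is invariant. *)
Lemma invariant_of_blocks (l : nat) (v0 v1 : H) :
  (forall x : block_tuple a l.+4, v0 = P (val x) v1) ->
  let q := P [:: la] v1 in
  forall s, P [:: s] (q + P [:: la] q) = q + P [:: la] q.
Proof.
move=> v01 q; set q' := P [:: la] q.
have v0E w : size w = l.+4 -> block a w -> v0 = P w v1.
  move=> /eqP sw bw; exact: (v01 (exist _ (Tuple sw) bw)).
have nc x s : no_cancel x s = (s != letter_inv x :> L) by [].
have la_nc s : s != ia -> no_cancel la s by [].
have la_ia : la != ia by rewrite xpair_eqE andbF.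
have path_nseq (j : nat) w : path (@no_cancel n) la (nseq j la ++ w) = path (@no_cancel n) la w.
  by elim: j => //= j ->; rewrite la_nc.
have path_la (j : nat) s : s != ia -> path (@no_cancel n) la (nseq j la ++ [:: s]).
  by move=> sa; rewrite path_nseq /= la_nc.
have qs s : s != ia -> P [:: s] v1 = q.
  have e t : t != ia -> v0 = P (la :: (nseq l.+2 la ++ [:: t])) v1.
    move=> ta; apply: v0E; first by rewrite [size _]/= size_cat size_nseq addn1.
    by rewrite /block eqxx path_la // last_cat.
  move=> sa; apply: (@word_act_inj (la :: nseq l.+2 la)); rewrite -!word_actD.
  exact: etrans (esym (e s sa)) (e la la_ia).
have v0q u : size u = l.+2 -> path (@no_cancel n) la u -> v0 = P (la :: u) q.
  move=> su pu; have [h1 h2] := closing_ok ab (last la u).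
  rewrite -(qs _ h2) -word_actD; apply: v0E; first by rewrite /= size_cat su addn1.
  by rewrite /= eqxx cat_path pu last_cat /= h1.
clearbody q.
have qq' s : P [:: s] q = q'.
  have [->|sa] := eqVneq s ia.
    (* the letter b separates a from its inverse *)
    have e t : no_cancel lb t -> v0 = P (la :: ((nseq l la ++ [:: lb]) ++ [:: t])) q.
      move=> ta; apply: v0q; first by rewrite !size_cat size_nseq /= addn1 addn1.
      by rewrite -catA path_nseq /= ta !nc !xpair_eqE /= !andbF.
    apply: (@word_act_inj (la :: nseq l la ++ [:: lb])); rewrite -!word_actD.
    apply: etrans (esym (e ia _)) (e la _); rewrite nc xpair_eqE /= ?andbF //.
    by rewrite (negPf ab).
  have e t : t != ia -> v0 = P (la :: (nseq l.+1 la ++ [:: t])) q.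
    by move=> ta; apply: v0q; rewrite ?path_la // size_cat size_nseq addn1.
  apply: (@word_act_inj (la :: nseq l.+1 la)); rewrite -!word_actD.
  exact: etrans (esym (e s sa)) (e la la_ia).
by move=> s; rewrite raddfD /= qq' -(qq' (letter_inv s)) letter_act_inv addrC.
Qed.

End Presented.

Section GoodSample.
Variables (R : realType) (n l j m : nat) (a b : 'I_n).
Hypothesis ab : a != b.
Local Notation X := (block_tuple a l.+4).
Local Notation k := (l.+4 + (l.+4 + (j + l.+4)))%N.
Definition cyc_word := {w : relator n k | w \in cyc_red_words n k}.

Definition encode (t : X * X * X) : cyc_word :=
  exist (fun w => w \in cyc_red_words n k) _ (encode_cyc j t).

Lemma encode_injective : injective encode.
Proof. by move=> t t' /(congr1 val) /= /encode_inj. Qed.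
Local Notation N := (#|{: X}|).
Local Notation M := (#|{: cyc_word}|).

(** If v is moved by at most e |v| by the letters, with e = 1 / (20 k), every
    word of length k moves it by at most B = |v| / 20.  The triple of
    [invariant_triple] then has v0 at distance at most 8 B of v, and the
    invariant vector of [invariant_of_blocks] is at distance at most 21 B,
    hence less than 2 |v|, of 2 v. *)
Lemma good_sample_propertyT (i : nat) (eta : R) (r : {ffun 'I_m -> cyc_word})
    (rs : {set relator n k}) :
  0 < eta -> (0 < m)%N -> (0 < N)%N -> (0 < M)%N ->
  2 * eta = 1 / 6 * (m%:R / M%:R * N%:R ^+ 2) ->
  good_sample (triple_mx R encode) i eta r ->
  (forall i, val (r i) \in rs) ->
  propertyT R (random_group rs).
Proof.
move=> eta0 m0 N0 M0 etaE gr rrs.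
set rels := [set w : word 'I_n | exists2 r : relator n k, r \in rs & w = tval r].
exists (letter_classes rels); first exact: letter_classes_generate.
move=> H ip pi ipP piP ai.
pose cls := word_class rels.
pose fa (x : X) := cls (val x).
pose fc (x : X) := cls (nseq j (a, false) ++ val x).
have wt1 x y z : triple_count R encode r x y z != 0 -> (fa x * fa y * fc z = 1)%g.
  rewrite pnatr_eq0 cards_eq0 => /set0Pn[i0]; rewrite finset.inE => /eqP e.
  rewrite /fa /fc /cls -!cls_cat; apply/word_class_eq/pres_rel; exists (val (r i0)) => //.
  by rewrite -e /= -catA.
have kappa0 : 0 < m%:R / M%:R :> R by rewrite divr_gt0 // ltr0n.
have U := good_sample_uniform (re_dot_inner ipP) eta0 m0 M0 etaE gr.
pose e0 : R := (20 * k%:R)^-1.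
have k0 : 0 < k%:R :> R by rewrite ltr0n.
have e00 : 0 < e0 by rewrite invr_gt0 mulr_gt0.
have [v v0 hv] := ai e0 e00.
pose e := e0 * rnorm v.
have he s : rnorm (pi (cls [:: s]) v - v) <= e.
  have := hv (cls [:: s]); rewrite !norm_rnorm -rmorphM ltcR => h; apply: ltW; apply: h.
  by apply/mapP; exists s; rewrite ?mem_enum.
have rv : 0 < rnorm v.
  by rewrite lt_neqAle rnorm_ge0 andbT eq_sym; apply: contra_neq v0; exact: rnorm0_eq0.
have hw w : (size w <= k)%N -> rnorm (pi (cls w) v - v) <= k%:R * e.
  move=> wk; apply: le_trans (word_act_almost ipP piP w he) _.
  by rewrite ler_wpM2r ?ler_nat // mulr_ge0 ?ltW.
have [v0' [v1 [v2 [h01 _ _ hd]]]] := invariant_triple ipP piP N0 kappa0 U wt1 v.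
pose B := k%:R * e.
have rnormE : rnorm v = 20 * B by rewrite /B /e /e0; field; rewrite gt_eqF.
have B0 : 0 < B by rewrite /B /e !mulr_gt0.
have eB : e <= B by rewrite /B ler_peMl ?ler1n // /e mulr_ge0 ?ltW.
have hwB w : (size w <= k)%N -> rnorm (pi (cls w) v - v) <= B by exact: hw.
clearbody B.
have NR : 0 < N%:R :> R by rewrite ltr0n.
have edge (f : X -> presented rels) : (forall x, rnorm (pi (f x) v - v) <= B) ->
    edge_energy (re_dot ip) (fun g u => pi g u) f v v <= N%:R * B ^+ 2.
  move=> hf; rewrite [leRHS]mulr_natl -sumr_const; apply: ler_sum => x _.
  by rewrite -(rnorm_sqr ipP (v - _)) rnormB lerXn2r ?nnegrE ?rnorm_ge0 ?hf // ltW.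
have size_block (x : X) : size (val x) = l.+4 by rewrite size_tuple.
have hfa x : rnorm (pi (fa x) v - v) <= B.
  by apply: hwB; rewrite size_block leq_addr.
have hfc x : rnorm (pi (fc x) v - v) <= B.
  by apply: hwB; rewrite size_cat size_nseq size_block addnA leq_addl.
have energy_le : energy (re_dot ip) (fun g u => pi g u) fa fa fc v v v <= (2 * B) ^+ 2.
  rewrite /energy ler_pdivrMr //.
  apply: le_trans (lerD (lerD (edge _ hfa) (edge _ hfa)) (edge _ hfc)) _.
  rewrite -!mulrDr mulrC ler_wpM2r //.
  rewrite (_ : (2 * B) ^+ 2 = 4 * B ^+ 2); last by ring.
  by have := sqr_ge0 B; lra.
have d0 : rnorm (v0' - v) <= 8 * B.
  apply: le_trans hd _; rewrite (_ : 8 * B = 4 * (2 * B)); last by ring.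
  rewrite ler_wpM2l //.
  have -> : 2 * B = Num.sqrt ((2 * B) ^+ 2) by rewrite sqrtr_sqr ger0_norm ?mulr_ge0 ?ltW.
  exact: ler_wsqrtr.
have [x0 _] : exists x0 : X, true by case/card_gt0P: N0 => x0 _; exists x0.
have d1 : rnorm (v1 - v) <= 9 * B.
  rewrite -(rnorm_pi ipP piP (fa x0)) raddfB /= -h01.
  rewrite (_ : v0' - _ = (v0' - v) + (v - pi (fa x0) v)); last by rewrite addrA subrK.
  apply: le_trans (rnormD _ _) _; rewrite (rnormB v).
  by have := hfa x0; lra.
pose P s := pi (cls [:: s]).
have dP s w d : rnorm (w - v) <= d -> rnorm (P s w - v) <= d + B.
  move=> wd; rewrite (_ : P s w - v = P s (w - v) + (P s v - v)).
    apply: le_trans (rnormD _ _) _; rewrite (rnorm_pi ipP piP).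
    by apply: lerD => //; apply: le_trans (he s) eB.
  by rewrite raddfB /= addrA subrK.
pose q := P (a, false) v1; pose u := q + P (a, false) q.
have dq : rnorm (q - v) <= 10 * B by have := dP (a, false) _ _ d1; rewrite -/q; lra.
have dq' : rnorm (P (a, false) q - v) <= 11 * B by have := dP (a, false) _ _ dq; lra.
have u_inv s : P s u = u by apply: (invariant_of_blocks piP ab h01).
exists u.
  apply/eqP => u0; have : rnorm (u - (v + v)) <= 21 * B.
    rewrite /u opprD addrACA; apply: le_trans (rnormD _ _) _; lra.
  rewrite u0 sub0r /rnorm normrN -mulr2n normrMn raddfMn /= -/(rnorm v) rnormE.
  by rewrite -mulr_natl; lra.
move=> g; rewrite -(word_class_repr g).
elim: (repr g) => [|s w IHw]; first exact: (word_act0 piP).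
by rewrite -cat1s (word_actD piP) IHw u_inv.
Qed.
End GoodSample.

(** * Lower bound for the probability *)

(** The constant of [bad_samples_le] for matrices of row sum 3, divided by the
    2P-th power of the threshold 1 / 12 used in [moment_ratio]. *)
Definition error_const (R : realType) (i : nat) : R :=
  let P := (2 ^ i)%N in
  ((2 * P)%:R * (2 * 3) + 1) ^+ (2 * P) * 3 *
  (1 + 3 * (P%:R ^+ P * expR (4 * 3))) * 12 ^+ (2 * P).

Lemma error_const_ge0 (R : realType) i : 0 <= error_const R i.
Proof. by rewrite !mulr_ge0 ?exprn_ge0 ?addr_ge0 ?mulr_ge0 ?exprn_ge0 ?expR_ge0. Qed.

(** Arithmetic of Markov's inequality with threshold D / 12, half of the
    deviation D / 6 allowed by [energy_le_slope]; N + N + N is the number of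
    vertices of the hypergraph. *)
Lemma moment_ratio (R : realType) (P : nat) (N D K Q B T : R) :
  1 <= N -> 1 <= D -> 0 < T -> 0 <= K -> 0 <= Q ->
  B * (D / 12) ^+ (2 * P) <= T * (K * (N + N + N) * (1 + (N + N + N) * Q * D ^+ P)) ->
  B / T <= K * 3 * (1 + 3 * Q) * 12 ^+ (2 * P) * N ^+ 2 / D ^+ P.
Proof.
move=> N1 D1 T0 K0 Q0; have t0 : 0 < 12 ^+ (2 * P) :> R by rewrite exprn_gt0.
rewrite exprMn exprVn; move: (12 ^+ (2 * P)) t0 => t t0.
rewrite mul2n -addnn exprD; have z1 : 1 <= D ^+ P by rewrite exprn_ege1.
move: (D ^+ P) z1 => z z1 h; have z0 : 0 < z by apply: lt_le_trans z1.
have e0 : 0 < z * z / t by rewrite divr_gt0 ?mulr_gt0.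
rewrite ler_pdivrMr // -(ler_pM2r e0); apply: le_trans h _.
rewrite (_ : _ / z * T * _ = T * (K * (N + N + N) * (N * (1 + 3 * Q) * z))); last first.
  by field; rewrite !gt_eqF.
have N0 : 0 <= N by apply: le_trans N1.
rewrite ler_wpM2l ?(ltW T0) // ler_wpM2l //; first by rewrite !(mulr_ge0, addr_ge0).
rewrite (_ : _ * (1 + _) * z = N * z + (N + N + N) * Q * z); last by ring.
by rewrite lerD2r -[leLHS]mulr1 ler_pM.
Qed.

Section Probability.
Variables (R : realType) (n l j : nat) (d : R) (a b : 'I_n).
Hypothesis ab : a != b.
Local Notation k := (l.+4 + (l.+4 + (j + l.+4)))%N.
Local Notation m := (num_relators n k d).
Local Notation X := (block_tuple a l.+4).
Local Notation N := (#|{: X}|%:R : R).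
Local Notation M := (#|cyc_red_words n k|).
Local Notation D := (m%:R * N ^+ 2 / M%:R).
Local Notation S := (cyc_word n l j).

Lemma card_cyc_word : #|{: S}| = M.
Proof. by rewrite card_sig; apply: eq_card => w; rewrite !finset.inE. Qed.

(** Here D is the expected number of sampled triples with a given element of X
    in a given position. *)
Lemma prob_ge i : (0 < m)%N -> (m <= M)%N -> (0 < #|{: X}|)%N -> 12 <= D ->
  1 - error_const R i * N ^+ 2 / D ^+ (2 ^ i) <= prob_propertyT n k d.
Proof.
move=> m0 mM N0 D12; set P := (2 ^ i)%N.
have M0 : (0 < M)%N by apply: leq_trans mM.
have D0 : 0 < D by lra.
have D1 : 1 <= D by lra.
have D12' : 4 * 3 <= D by lra.
pose eta : R := D / 12.
have eta0 : 0 < eta by rewrite divr_gt0.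
pose A := triple_mx R (@encode n l j a).
pose good (r : {ffun 'I_m -> S}) := `[< good_sample A i eta r >].
have M0R : 0 < M%:R :> R by rewrite ltr0n.
have M0m : 0 < M%:R ^+ m :> R by rewrite exprn_gt0.
have bad : #|[set r | ~~ good r]%SET|%:R / M%:R ^+ m <= error_const R i * N ^+ 2 / D ^+ P.
  have SM := card_cyc_word.
  have AD v : m%:R * (\sum_x \sum_w A x v w) <= 3 * D * #|{: S}|%:R.
    rewrite triple_mx_total.
    by rewrite SM le_eqVlt; apply/orP; left; apply/eqP; field; rewrite gt_eqF.
  have S0 : (0 < #|{: S}|)%N by rewrite SM.
  have h := @bad_samples_le R _ _ m A i 3 D 3 eta m0 S0 eta0 D0 (ler0n _ 3).
  have {}h := h (@triple_mx_ge0 R _ _ _).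
  have {}h := h (triple_mx_row R (@encode_injective n l j a)).
  have {}h := h D12' AD.
  rewrite SM !card_sum in h.
  rewrite natrD natrD in h.
  have N1 : 1 <= N by rewrite ler1n.
  rewrite -/P in h; rewrite /error_const -/P.
  apply: (moment_ratio N1 D1 M0m _ _ h).
    by rewrite !(exprn_ge0, addr_ge0, mulr_ge0).
  by rewrite mulr_ge0 ?exprn_ge0 ?expR_ge0.
have mS : (m <= #|{: S}|)%N by rewrite card_cyc_word.
have := sample_to_subset R mS good; rewrite card_cyc_word => cp.
have goodE : #|[set r | good r]%SET|%:R / M%:R ^+ m =
    1 - #|[set r | ~~ good r]%SET|%:R / M%:R ^+ m :> R.
  have : (#|[set r | good r]%SET| + #|[set r | ~~ good r]%SET| = M ^ m)%N.
    rewrite -card_cyc_word -[X in (_ ^ X)%N]card_ord -card_ffun.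
    rewrite -(cardsC [set r | good r]%SET); congr (_ + _)%N.
    by apply: eq_card => r; rewrite !finset.inE.
  move=> /(congr1 (fun x => x%:R : R)); rewrite natrD natrX => e.
  have -> : #|[set r | good r]%SET|%:R = M%:R ^+ m - #|[set r | ~~ good r]%SET|%:R :> R.
    by rewrite -e addrK.
  by rewrite mulrBl divff // gt_eqF.
apply: (@le_trans _ _ (1 - #|[set r | ~~ good r]%SET|%:R / M%:R ^+ m)).
  by rewrite lerD2l lerN2.
rewrite -goodE; apply: le_trans cp _.
rewrite /prob_propertyT /uniform_on_prob (_ : #|relator_sets n k d| = 'C(M, m)); last first.
  by rewrite -cards_draws.
rewrite ler_wpM2r ?invr_ge0 // ler_nat.
have img_inj : injective (fun U : {set S} => val @: U) by apply: imset_inj; exact: val_inj.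
rewrite -(card_imset _ img_inj); apply: subset_leq_card; apply/fintype.subsetP => rs /imsetP[U].
rewrite finset.inE => /andP[/eqP Um /existsP[r /andP[/asboolP gr rU]]] ->.
rewrite !finset.inE card_imset ?Um ?eqxx ?andbT; last exact: val_inj.
apply/andP; split.
  by apply/fintype.subsetP => w /imsetP[x _ ->]; exact: valP.
apply/asboolP; apply: (good_sample_propertyT ab eta0 m0 N0 _ _ gr).
- by rewrite card_cyc_word.
- by rewrite card_cyc_word /eta; field; rewrite gt_eqF.
- by move=> i0; apply: imset_f; move/range_subP : rU; exact.
Qed.
End Probability.

(** * Letting the length of the relators grow *)

Lemma base_ge3 (R : realType) n : (2 <= n)%N -> 3 <= (2 * n - 1)%:R :> R.
Proof. by move=> hn; rewrite ler_nat; lia. Qed.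

Section Asymptotics.
Variables (R : realType) (n : nat) (d : R).
Hypothesis hn : (2 <= n)%N.
Hypothesis hd : 1 / 3 < d.
Hypothesis hd1 : d < 1.
Local Notation B := ((2 * n - 1)%N%:R : R).

Let B0 : 0 < B. Proof. exact: lt_le_trans (base_ge3 R hn). Qed.
Let B1 : 1 <= B. Proof. by apply: le_trans (base_ge3 R hn); rewrite ler1n. Qed.

Lemma num_relators_bounds k :
  B `^ (k%:R * d) / 2 <= (num_relators n k d)%:R <= B `^ (k%:R * d).
Proof.
have x1 : 1 <= B `^ (k%:R * d).
  rewrite -[X in X <= _](powRr0 B) ler_powR // mulr_ge0 //.
  by apply: le_trans (ltW hd); rewrite divr_ge0.
rewrite /num_relators.
have /truncn_itv : 0 <= B `^ (k%:R * d) by apply: le_trans x1.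
set t := Num.truncn _ => /andP[t1 t2]; rewrite t1 andbT.
have t0 : (0 < t)%N by rewrite /t truncn_gt0.
rewrite ler_pdivrMr // (le_trans (ltW t2)) // -natrM ler_nat; lia.
Qed.

Lemma card_cyc_red_le k : (0 < k)%N -> #|cyc_red_words n k|%:R <= 2 * B ^+ k.
Proof.
case: k => // k _; rewrite -natrX -natrM ler_nat.
apply: leq_trans (card_cyc_red n k) _; rewrite expnS mulnA leq_mul2r.
by apply/orP; right; lia.
Qed.

Section FixedLength.
Variables (a b : 'I_n) (l j : nat).
Hypothesis ab : a != b.
Hypothesis j2 : (j <= 2)%N.
Local Notation k := (l.+4 + (l.+4 + (j + l.+4)))%N.
Local Notation m := (num_relators n k d).
Local Notation N := #|{: block_tuple a l.+4}|.
Local Notation M := #|cyc_red_words n k|.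

Lemma card_block_ge : B ^+ l.+2 <= N%:R.
Proof. by rewrite -natrX ler_nat (card_block ab). Qed.

Lemma card_block_cube : (N ^ 3 <= M)%N.
Proof.
rewrite -(card_cyc_word n l j) (leq_trans _ (leq_card _ (@encode_injective n l j a))) //.
by rewrite !card_prod !expnS expn0 muln1 mulnA.
Qed.

Lemma card_block_le : N%:R <= 2 * B ^+ k.
Proof.
apply: le_trans (card_cyc_red_le _); last by [].
rewrite ler_nat (leq_trans _ card_block_cube) //.
by case: N => // p; rewrite expnS leq_pmulr // expn_gt0.
Qed.

Lemma num_relators_le : 8 <= k%:R * (1 - d) -> (m <= M)%N.
Proof.
move=> hk; rewrite -(ler_nat R).
have /andP[_ h] := num_relators_bounds k; apply: le_trans h _.
apply: (@le_trans _ _ (N%:R ^+ 3)); last by rewrite -natrX ler_nat card_block_cube.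
apply: (@le_trans _ _ ((B ^+ l.+2) ^+ 3)); last first.
  by rewrite lerXn2r ?nnegrE ?exprn_ge0 ?(ltW B0) // card_block_ge.
rewrite -exprM -powR_mulrn ?(ltW B0) // ler_powR //.
have : k%:R = (l.+2 * 3)%:R + (j%:R + 6) :> R by rewrite -natrD -natrD; congr _%:R; lia.
have : j%:R <= 2 :> R by rewrite ler_nat.
lra.
Qed.

(** Up to constants, D is b ^ (k d) * (b ^ (k / 3)) ^ 2 / b ^ k; the factor
    b ^ (-6) absorbs the letters lost by rounding k / 3 and by the end
    conditions on blocks. *)
Lemma mean_degree_ge :
  B `^ (-6) / 4 * (B `^ (d - 1 / 3)) ^+ k <= m%:R * N%:R ^+ 2 / M%:R.
Proof.
have M0 : 0 < M%:R :> R.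
  rewrite ltr0n (leq_trans _ card_block_cube) // expn_gt0 orbF.
  by rewrite -(ltr_nat R) (lt_le_trans _ card_block_ge) // exprn_gt0.
have /andP[hm _] := num_relators_bounds k.
rewrite ler_pdivlMr //.
apply: (@le_trans _ _ (B `^ (-6) / 4 * (B `^ (d - 1 / 3)) ^+ k * (2 * B ^+ k))).
  by rewrite ler_wpM2l ?card_cyc_red_le // mulr_ge0 ?exprn_ge0 ?divr_ge0 ?powR_ge0.
apply: (@le_trans _ _ (B `^ (k%:R * d) / 2 * (B ^+ l.+2) ^+ 2)); last first.
  apply: ler_pM => //; rewrite ?divr_ge0 ?powR_ge0 ?exprn_ge0 ?(ltW B0) //.
  by rewrite lerXn2r ?nnegrE ?exprn_ge0 ?(ltW B0) // card_block_ge.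
rewrite -powR_mulrn ?powR_ge0 // -powRrM -exprM -!powR_mulrn ?(ltW B0) //.
have Bn0 : B != 0 by rewrite gt_eqF.
rewrite (_ : _ / 4 * _ * _ = (B `^ (-6) * B `^ ((d - 1 / 3) * k%:R) * B `^ k%:R) / 2); last by field.
rewrite -!powRD ?Bn0 ?implybT //.
rewrite [leRHS]mulrAC -powRD ?Bn0 ?implybT // ler_wpM2r //.
rewrite ler_powR //.
have : k%:R = (l.+2 * 3)%:R + (j%:R + 6) :> R by rewrite -natrD -natrD; congr _%:R; lia.
have : j%:R <= 2 :> R by rewrite ler_nat.
rewrite !natrM; lra.
Qed.

(** N ^ 2 is at most 4 b ^ (2 k), while the choice of i makes D ^ P exceed a
    constant times b ^ (3 k). *)
Lemma prob_ge_explicit i :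
  8 <= k%:R * (1 - d) -> 12 <= B `^ (-6) / 4 * (B `^ (d - 1 / 3)) ^+ k ->
  3 <= (d - 1 / 3) * (2 ^ i)%:R ->
  1 - error_const R i * 4 / (B `^ (-6) / 4) ^+ (2 ^ i) * B^-1 ^+ k <= prob_propertyT n k d.
Proof.
move=> hk h12 hi.
have N0 : (0 < N)%N by rewrite -(ltr_nat R) (lt_le_trans _ card_block_ge) // exprn_gt0.
have m0 : (0 < m)%N.
  rewrite -(ltr_nat R); have /andP[+ _] := num_relators_bounds k; apply: lt_le_trans.
  by rewrite divr_gt0 // powR_gt0.
have D12 := le_trans h12 mean_degree_ge.
apply: le_trans (@prob_ge R n l j d a b ab i m0 (num_relators_le hk) N0 D12).
rewrite lerD2l lerN2.
set c1 := B `^ (-6) / 4 in h12 *; set rho := B `^ _ in h12 *; set P := (2 ^ i)%N in hi *.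
have c10 : 0 < c1 by rewrite divr_gt0 // powR_gt0.
have rho0 : 0 < rho by rewrite powR_gt0.
have cr : 0 < c1 * rho ^+ k by rewrite mulr_gt0 // exprn_gt0.
have cr0 : 0 < (c1 * rho ^+ k) ^+ P by rewrite exprn_gt0.
have D0 : 0 < m%:R * N%:R ^+ 2 / M%:R :> R by apply: lt_le_trans D12.
have DP : (c1 * rho ^+ k) ^+ P <= (m%:R * N%:R ^+ 2 / M%:R) ^+ P.
  by rewrite lerXn2r ?nnegrE ?(ltW D0) ?(ltW cr) // mean_degree_ge.
apply: (@le_trans _ _ (error_const R i * (2 * B ^+ k) ^+ 2 / (c1 * rho ^+ k) ^+ P)).
  apply: ler_pM.
  - by rewrite mulr_ge0 ?error_const_ge0 ?exprn_ge0.
  - by rewrite invr_ge0 exprn_ge0 // ltW.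
  - by rewrite ler_wpM2l ?error_const_ge0 // lerXn2r ?nnegrE ?card_block_le //.
  - by rewrite lef_pV2 ?posrE // exprn_gt0.
have rhoP : B ^+ 3 <= rho ^+ P.
  by rewrite -(powR_mulrn P (ltW rho0)) /rho -powRrM -(powR_mulrn 3 (ltW B0)) ler_powR.
have key : B ^+ k ^+ 3 <= (rho ^+ k) ^+ P.
  rewrite exprAC [leRHS]exprAC lerXn2r ?nnegrE ?exprn_ge0 ?(ltW rho0) ?(ltW B0) //.
rewrite [(c1 * _) ^+ _]exprMn [B^-1 ^+ _]exprVn.
have c1P : 0 < c1 ^+ P by rewrite exprn_gt0.
have Bk : 0 < B ^+ k by rewrite exprn_gt0.
have Q0 := error_const_ge0 R i.
move: (error_const R i) (c1 ^+ P) (B ^+ k) ((rho ^+ k) ^+ P) Q0 c1P Bk key.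
move=> Q t z w Q0 t0 z0 zw; have w0 : 0 < w by apply: lt_le_trans zw; rewrite exprn_gt0.
rewrite (_ : Q * (2 * z) ^+ 2 / (t * w) = Q * 4 / t * (z ^+ 2 / w)); last first.
  by field; rewrite !gt_eqF.
rewrite ler_wpM2l //; first by rewrite divr_ge0 ?mulr_ge0 // ltW.
by rewrite ler_pdivrMr // ler_pdivlMl // -exprS.
Qed.
End FixedLength.

Lemma prob_ge_large (k i : nat) : (12 <= k)%N ->
  8 <= k%:R * (1 - d) -> 12 <= B `^ (-6) / 4 * (B `^ (d - 1 / 3)) ^+ k ->
  3 <= (d - 1 / 3) * (2 ^ i)%:R ->
  1 - error_const R i * 4 / (B `^ (-6) / 4) ^+ (2 ^ i) * B^-1 ^+ k <= prob_propertyT n k d.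
Proof.
move=> k12.
have n0 : (0 < n)%N by apply: leq_trans hn.
have ab : Ordinal n0 != Ordinal hn by [].
have [l [j [j2 ->]]] : exists l j, (j <= 2)%N /\ k = (l.+4 + (l.+4 + (j + l.+4)))%N.
  by exists (k %/ 3 - 4)%N, (k %% 3)%N; split; lia.
exact: (prob_ge_explicit ab j2).
Qed.

Lemma prob_le1 k : prob_propertyT n k d <= 1.
Proof.
rewrite /prob_propertyT /uniform_on_prob.
have [->|C0] := eqVneq (#|relator_sets n k d|) 0%N; first by rewrite invr0 mulr0.
rewrite ler_pdivrMr ?ltr0n ?lt0n // mul1r ler_nat; apply: subset_leq_card.
by apply/fintype.subsetP => U; rewrite finset.inE => /andP[].
Qed.

End Asymptotics.

Theorem theorem2 (R : realType) (n : nat) (d : R)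
    (hn : (2 <= n)%N) (hd : 1 / 3 < d) (hd1 : d < 1) :
  prob_propertyT n k d @[k --> \oo] --> (1 : R).
Proof.
have B3 := @base_ge3 R n hn; set B : R := (2 * n - 1)%:R in B3.
have eps0 : 0 < d - 1 / 3 by rewrite subr_gt0.
(* with this i, D ^ (2 ^ i) is at least a constant times b ^ (3 k) *)
have [i hi] : exists i, 3 <= (d - 1 / 3) * (2 ^ i)%:R.
  exists (Num.truncn (3 / (d - 1 / 3))); rewrite mulrC -ler_pdivrMr //.
  apply: le_trans (ltW (truncnS_gt _)) _; rewrite ler_nat; exact: ltn_expl.
pose c1 : R := B `^ (-6) / 4; pose rho : R := B `^ (d - 1 / 3).
pose C : R := error_const R i * 4 / c1 ^+ (2 ^ i).
have B0 : 0 < B by lra.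
have c10 : 0 < c1 by rewrite divr_gt0 // powR_gt0.
have rho1 : 1 < rho.
  rewrite /rho /powR gt_eqF // expR_gt1 mulr_gt0 // ln_gt0 //; lra.
have rho0 : 0 < rho by apply: lt_trans rho1.
apply: (@squeeze_cvgr _ _ _ _ (fun k => 1 - C * B^-1 ^+ k) (fun=> 1)); last first.
- exact: cvg_cst.
- rewrite -[X in _ --> X]subr0; apply: cvgB; first exact: cvg_cst.
  apply: cvg_geometric; rewrite ger0_norm ?invr_ge0 ?(ltW B0) // invf_lt1 //; lra.
have large : \forall k \near \oo, 12 <= c1 * rho ^+ k.
  have /(cvg_geometric (12 / c1)) : `|rho^-1| < 1.
    by rewrite ger0_norm ?invr_ge0 ?(ltW rho0) // invf_lt1.
  move=> /cvgrPdist_lt /(_ 1 ltr01); apply: filterS => k.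
  have rk : 0 < rho ^+ k by rewrite exprn_gt0.
  rewrite sub0r normrN /= => /(le_lt_trans (ler_norm _)) /ltW.
  by rewrite /geometric /= exprVn ler_pdivrMr // mul1r ler_pdivrMr // mulrC.
near=> k; rewrite prob_le1 andbT; apply: (prob_ge_large hn hd hd1) => //.
- by near: k; exact: nbhs_infty_ge.
- rewrite -ler_pdivrMr ?subr_gt0 //; near: k; exact: nbhs_infty_ger.
- by near: k.
Unshelve. all: by end_near.
Qed.
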